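(* Let $(\{R_{i}\}_{i\geq 0},\{t_i\}_{i\geq 0})$ be a perfectoid tower arising from some pair $(R_0,I_0)$, let $R_\infty=\varinjlim_{i\ge0}R_i$, and let $I_1\subseteq R_1$ be its first perfectoid pillar. Let $\widehat{R_{\infty}}$ denote the $I_{1}$-adic completion of $R_{\infty}$. Then $\widehat{R_\infty}$ is a perfectoid ring.
   Context: Fix a prime $p$. All rings are commutative and unital. A pair $(R,I_0)$ is a ring with an ideal. A tower of rings $(\{R_i\}_{i\ge 0},\{t_i\}_{i\ge 0})$ is a sequence of rings with ring maps $t_i:R_i\to R_{i+1}$; each $R_i$ is an algebra over $R_j$ ($j\le i$) via these maps. Torsion: for an ideal $I$ of a ring $A$ and an $A$-module $M$, $M_{I\text{-tor}}$ is the submodule of those $m\in M$ such that for every $x\in I$ there is $n>0$ with $x^nm=0$. Purely inseparable tower arising from $(R,I_0)$: (a) $R_0=R$ and $p\in I_0$; (b) for each $i\ge0$ the map $\overline{t_i}:R_i/I_0R_i\to R_{i+1}/I_0R_{i+1}$ induced by $t_i$ is injective; (c) for each $i\ge0$ the image of the Frobenius endomorphism of $R_{i+1}/I_0R_{i+1}$ is contained in the image of $\overline{t_i}$. Write $\overline{R_i}:=R_i/I_0R_i$. The $i$-th Frobenius projection is the unique ring map $F_i:\overline{R_{i+1}}\to\overline{R_i}$ such that $\overline{t_i}\circ F_i$ is the Frobenius endomorphism of $\overline{R_{i+1}}$. Perfectoid tower arising from $(R,I_0)$: a purely inseparable tower arising from $(R,I_0)$ such that moreover: (d) every $F_i$ is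 surjective; (e) every $I_0R_i$ is contained in the Jacobson radical of $R_i$; (f) $I_0$ is principal, and $R_1$ contains a principal ideal $I_1$ with (f-1) $I_1^p=I_0R_1$ and (f-2) $\ker(F_i)=I_1\overline{R_{i+1}}$ for every $i\ge0$; (g) for every $i\ge0$, $I_0(R_i)_{I_0\text{-tor}}=(0)$, and there is a (unique) bijection $(F_i)_{\mathrm{tor}}:(R_{i+1})_{I_0\text{-tor}}\to(R_i)_{I_0\text{-tor}}$ compatible with $F_i$ under the natural maps $(R_k)_{I_0\text{-tor}}\hookrightarrow R_k\twoheadrightarrow\overline{R_k}$, $k=i,i+1$. The ideal $I_1$ is uniquely determined and is called the first perfectoid pillar. Perfectoid ring (Bhatt–Morrow–Scholze): a ring $S$ such that (1) $S$ is $\varpi$-adically complete and separated for some $\varpi\in S$ such that $\varpi^p$ divides $p$; (2) the Frobenius endomorphism on $S/pS$ is surjective; (3) the kernel of Fontaine's map $\theta_S:W(S^\flat)\to S$ is principal. Here $S^\flat=\varprojlim_{\mathrm{Frob}}S/pS$, $W$ denotes $p$-typical Witt vectors, and $\theta_S$ is the ring map lifting $W(S^\flat)\to S^\flat\to S/pS$ (reduction modulo $p$ followed by the first projection). *)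

(* Defs.v *)
From HB Require Import structures.
From mathcomp Require Import all_boot all_algebra.
From mathcomp Require Import generic_quotient ring_quotient finmap ring.
From mathcomp Require Import boolp classical_sets functions.
From mathcomp.multinomials Require Import monalg.

Set Implicit Arguments.
Unset Strict Implicit.
Unset Printing Implicit Defensive.
Import GRing.Theory Num.Theory.
Local Open Scope classical_set_scope.
Local Open Scope quotient_scope.
Local Open Scope ring_scope.

(* Rings are commutative and unital, and may be zero: comPzRingType. *)

Section Ideals.
Variable R : comPzRingType.

Definition is_ideal (J : set R) :=
  [/\ J 0, forall x y, J x -> J y -> J (x + y) & forall a x, J x -> J (a * x)].

Record ideal := Ideal { ideal_set :> set R; ideal_setP : is_ideal ideal_set }.

(* [set R] is not the class of functions, hence a second coercion to write
   [I x]. *)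
Definition in_ideal (I : ideal) (x : R) : Prop := ideal_set I x.
Coercion in_ideal : ideal >-> Funclass.

Lemma ideal_ext (I J : ideal) : (I : set R) = J -> I = J.
Proof. by case: I J => I hI [J hJ] /= e; subst J; congr Ideal. Qed.

Lemma ideal0 (I : ideal) : I 0. Proof. by case: (ideal_setP I). Qed.

Lemma idealD (I : ideal) x y : I x -> I y -> I (x + y).
Proof. by case: (ideal_setP I) => _ h _; apply: h. Qed.

Lemma idealM (I : ideal) a x : I x -> I (a * x).
Proof. by case: (ideal_setP I) => _ _; apply. Qed.

Lemma idealN (I : ideal) x : I x -> I (- x).
Proof. by move=> Ix; rewrite -mulN1r; apply: idealM. Qed.

Lemma idealB (I : ideal) x y : I x -> I y -> I (x - y).
Proof. by move=> Ix Iy; apply: idealD => //; apply: idealN. Qed.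

Lemma smallest_is_ideal (A : set R) : is_ideal (smallest is_ideal A).
Proof.
split=> [J [[] //]|x y hx hy J hJ|a x hx J hJ].
  by case: (hJ) => [[_ h _] _]; apply: h; [exact: hx|exact: hy].
by case: (hJ) => [[_ _ h] _]; apply: h; exact: hx.
Qed.

Definition ideal_gen (A : set R) := Ideal (smallest_is_ideal A).

Lemma ideal_gen_sub (A : set R) (I : ideal) : A `<=` I -> ideal_gen A `<=` I.
Proof. by move=> AI; apply: smallest_sub => //; exact: ideal_setP. Qed.

Lemma sub_ideal_gen (A : set R) : A `<=` ideal_gen A.
Proof. exact: sub_gen_smallest. Qed.

Definition principal_ideal (a : R) := ideal_gen [set a].

Lemma principal_idealP (a x : R) :
  principal_ideal a x <-> exists r, x = r * a.
Proof.
split=> [|[r ->]]; last by apply: idealM; apply: sub_ideal_gen.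
have hI : is_ideal [set x | exists r, x = r * a].
  split=> [|y z [r ->] [s ->]|b y [r ->]]; first by exists 0; rewrite mul0r.
    by exists (r + s); rewrite mulrDl.
  by exists (b * r); rewrite mulrA.
apply: (@ideal_gen_sub _ (Ideal hI)) => y -> /=.
by exists 1; rewrite mul1r.
Qed.

Definition is_principal (I : ideal) := exists a, I = principal_ideal a.

Definition ideal_mul (I J : ideal) :=
  ideal_gen [set x * y | x in (I : set R) & y in (J : set R)].

Definition ideal_pow (I : ideal) n := iter n (ideal_mul I) (principal_ideal 1).

Lemma ideal_powS (I : ideal) n : ideal_pow I n.+1 `<=` ideal_pow I n.
Proof.
by apply: ideal_gen_sub => _ [x Ix [y Iy <-]]; apply: idealM.
Qed.

Definition is_maximal (M : ideal) :=
  ~ M 1 /\ forall J : ideal, M `<=` J -> ~ J 1 -> J = M.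

Definition jacobson_radical : set R :=
  [set x | forall M : ideal, is_maximal M -> M x].

Definition ideal_pred (I : ideal) : {pred R} := fun x => `[< I x >].

Lemma ideal_pred_zmod_closed I : zmod_closed (ideal_pred I).
Proof.
split=> [|x y /asboolP Ix /asboolP Iy]; apply/asboolP; first exact: ideal0.
exact: idealB.
Qed.

HB.instance Definition _ I :=
  GRing.isZmodClosed.Build R (ideal_pred I) (ideal_pred_zmod_closed I).

End Ideals.

(* The library provides ring quotients only for proper ideals; here the unit
   ideal is allowed. *)
Section QuotientRing.
Variables (R : comPzRingType) (I : ideal R).

Definition quotient := Quotient.quot (ideal_pred I).

HB.instance Definition _ := GRing.Zmodule.on quotient.

Definition quot_proj (x : R) : quotient := \pi_(Quotient.quot (ideal_pred I)) x.

Definition quot_repr (x : quotient) : R :=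
  @repr R (Quotient.quot (ideal_pred I)) x.

Lemma quot_reprK : cancel quot_repr quot_proj.
Proof. by move=> x; rewrite /quot_proj /quot_repr reprK. Qed.

Lemma quot_projP x y : quot_proj x = quot_proj y <-> I (x - y).
Proof.
split=> [/eqP|h]; rewrite /quot_proj.
  by rewrite -Quotient.idealrBE => /asboolP.
by apply/eqP; rewrite -Quotient.idealrBE; apply/asboolP.
Qed.

Lemma quot_proj_is_zmod : zmod_morphism quot_proj.
Proof. by move=> x y; rewrite /quot_proj !raddfB. Qed.

HB.instance Definition _ :=
  GRing.isZmodMorphism.Build R quotient quot_proj quot_proj_is_zmod.

Definition quot_mul (x y : quotient) := quot_proj (quot_repr x * quot_repr y).

Lemma quot_mulE x y : quot_mul (quot_proj x) (quot_proj y) = quot_proj (x * y).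
Proof.
have hr z : I (quot_repr (quot_proj z) - z) by apply/quot_projP; rewrite quot_reprK.
apply/quot_projP.
rewrite -(subrKA (x * quot_repr (quot_proj y))) -mulrBl -mulrBr.
apply: idealD; last exact/idealM/hr.
by rewrite mulrC; apply/idealM/hr.
Qed.

Lemma quot_mulA : associative quot_mul.
Proof.
move=> x y z; rewrite -(quot_reprK x) -(quot_reprK y) -(quot_reprK z).
by rewrite !quot_mulE mulrA.
Qed.

Lemma quot_mulC : commutative quot_mul.
Proof. by move=> x y; rewrite /quot_mul mulrC. Qed.

Lemma quot_mul1 : left_id (quot_proj 1) quot_mul.
Proof. by move=> x; rewrite -(quot_reprK x) quot_mulE mul1r. Qed.

Lemma quot_mulDl : left_distributive quot_mul +%R.
Proof.
move=> x y z; rewrite -(quot_reprK x) -(quot_reprK y) -(quot_reprK z).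
by rewrite -raddfD !quot_mulE mulrDl raddfD.
Qed.

HB.instance Definition _ := GRing.Zmodule_isComPzRing.Build quotient
  quot_mulA quot_mulC quot_mul1 quot_mulDl.

Lemma quot_proj_is_monoid : monoid_morphism quot_proj.
Proof. by split=> // x y; rewrite -quot_mulE. Qed.

HB.instance Definition _ :=
  GRing.isMonoidMorphism.Build R quotient quot_proj quot_proj_is_monoid.

End QuotientRing.

Definition quot_map (R S : comPzRingType) (f : {rmorphism R -> S})
    (I : ideal R) (J : ideal S) (_ : forall x, I x -> J (f x))
    (x : quotient I) : quotient J := quot_proj J (f (quot_repr x)).

Section QuotientMap.
Variables (R S : comPzRingType) (f : {rmorphism R -> S}).
Variables (I : ideal R) (J : ideal S) (fIJ : forall x, I x -> J (f x)).

Local Notation quot_map := (quot_map fIJ).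

Lemma quot_mapE x : quot_map (quot_proj I x) = quot_proj J (f x).
Proof.
apply/quot_projP; rewrite -rmorphB; apply: fIJ.
by apply/quot_projP; rewrite quot_reprK.
Qed.

Lemma quot_map_is_zmod : zmod_morphism quot_map.
Proof.
move=> x y; rewrite -(quot_reprK x) -(quot_reprK y).
by rewrite -raddfB !quot_mapE !raddfB.
Qed.

Lemma quot_map_is_monoid : monoid_morphism quot_map.
Proof.
split=> [|x y]; first by rewrite -(rmorph1 (quot_proj I)) quot_mapE !rmorph1.
rewrite -(quot_reprK x) -(quot_reprK y).
by rewrite -rmorphM !quot_mapE !rmorphM.
Qed.

HB.instance Definition _ :=
  GRing.isZmodMorphism.Build (quotient I) (quotient J) quot_map quot_map_is_zmod.
HB.instance Definition _ :=
  GRing.isMonoidMorphism.Build (quotient I) (quotient J) quot_map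
    quot_map_is_monoid.

End QuotientMap.

Definition ideal_extension (R S : comPzRingType) (f : R -> S) (I : ideal R) :=
  ideal_gen (f @` I).

Lemma ideal_extension_preim (A R S : comPzRingType) (f : A -> R)
    (g : {rmorphism R -> S}) (I : ideal A) (J : ideal S) :
  (forall a, I a -> J (g (f a))) ->
  forall x, ideal_extension f I x -> J (g x).
Proof.
move=> h; have hJ : is_ideal [set x | J (g x)].
  split=> [|x y Jx Jy|a x Jx] /=.
  - by rewrite rmorph0; exact: ideal0.
  - by rewrite rmorphD; exact: idealD.
  - by rewrite rmorphM; exact: idealM.
by apply: (@ideal_gen_sub _ _ (Ideal hJ)) => _ [a Ia <-]; exact: h.
Qed.

Section InverseLimit.
Variables (Q : nat -> comPzRingType) (f : forall n, {rmorphism Q n.+1 -> Q n}).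

Record inverse_limit := InverseLimit {
  invlim_val :> forall n, Q n;
  invlim_valP : forall n, f n (invlim_val n.+1) = invlim_val n
}.

HB.instance Definition _ := gen_eqMixin inverse_limit.
HB.instance Definition _ := gen_choiceMixin inverse_limit.

Lemma invlim_ext (x y : inverse_limit) : (forall n, x n = y n) -> x = y.
Proof.
case: x y => x hx [y hy] /= e.
have {}e : x = y by apply: functional_extensionality_dep.
by subst y; congr InverseLimit; exact: Prop_irrelevance.
Qed.

Program Definition invlim_zero := @InverseLimit (fun=> 0) _.
Next Obligation. by rewrite rmorph0. Qed.
Program Definition invlim_one := @InverseLimit (fun=> 1) _.
Next Obligation. by rewrite rmorph1. Qed.
Program Definition invlim_opp (x : inverse_limit) :=
  @InverseLimit (fun n => - x n) _.
Next Obligation. by rewrite rmorphN invlim_valP. Qed.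
Program Definition invlim_add (x y : inverse_limit) :=
  @InverseLimit (fun n => x n + y n) _.
Next Obligation. by rewrite rmorphD !invlim_valP. Qed.
Program Definition invlim_mul (x y : inverse_limit) :=
  @InverseLimit (fun n => x n * y n) _.
Next Obligation. by rewrite rmorphM !invlim_valP. Qed.

Lemma invlim_addA : associative invlim_add.
Proof. by move=> x y z; apply: invlim_ext => n /=; rewrite addrA. Qed.
Lemma invlim_addC : commutative invlim_add.
Proof. by move=> x y; apply: invlim_ext => n /=; rewrite addrC. Qed.
Lemma invlim_add0 : left_id invlim_zero invlim_add.
Proof. by move=> x; apply: invlim_ext => n /=; rewrite add0r. Qed.
Lemma invlim_addN : left_inverse invlim_zero invlim_opp invlim_add.
Proof. by move=> x; apply: invlim_ext => n /=; rewrite addNr. Qed.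
Lemma invlim_mulA : associative invlim_mul.
Proof. by move=> x y z; apply: invlim_ext => n /=; rewrite mulrA. Qed.
Lemma invlim_mulC : commutative invlim_mul.
Proof. by move=> x y; apply: invlim_ext => n /=; rewrite mulrC. Qed.
Lemma invlim_mul1 : left_id invlim_one invlim_mul.
Proof. by move=> x; apply: invlim_ext => n /=; rewrite mul1r. Qed.
Lemma invlim_mulDl : left_distributive invlim_mul invlim_add.
Proof. by move=> x y z; apply: invlim_ext => n /=; rewrite mulrDl. Qed.

HB.instance Definition _ := GRing.isZmodule.Build inverse_limit
  invlim_addA invlim_addC invlim_add0 invlim_addN.
HB.instance Definition _ := GRing.Zmodule_isComPzRing.Build inverse_limit
  invlim_mulA invlim_mulC invlim_mul1 invlim_mulDl.

End InverseLimit.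

Section Completion.
Variables (R : comPzRingType) (I : ideal R).

Definition completion :=
  @inverse_limit (fun n => quotient (ideal_pow I n))
    (fun n => @quot_map R R idfun (ideal_pow I n.+1) (ideal_pow I n)
                (@ideal_powS R I n)).

HB.instance Definition _ := GRing.ComPzRing.on completion.

Program Definition to_completion (x : R) : completion :=
  @InverseLimit _ _ (fun n => quot_proj (ideal_pow I n) x) _.
Next Obligation. by rewrite quot_mapE. Qed.

Definition adically_complete_separated := bijective to_completion.

End Completion.

Section DirectedColimit.
Variables (R : nat -> comPzRingType) (t : forall i, {rmorphism R i -> R i.+1}).

Let T : Type := {i : nat & R i}.

(* The colimit is the disjoint union of the R i modulo the relation that
   identifies two elements with a common image further in the sequence. *)
Definition colim_step (u : T) : T := existT _ (tag u).+1 (t (tag u) (tagged u)).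

Definition colim_rel (u v : T) : bool :=
  `[< exists k l, iter k colim_step u = iter l colim_step v >].

Lemma colim_rel_equiv : equiv_class_of colim_rel.
Proof.
split=> [u|u v|v u w].
- by apply/asboolP; exists 0, 0.
- by apply/asboolP/asboolP => -[k [l e]]; exists l, k.
- move=> /asboolP[k [l e]] /asboolP[k' [l' e']]; apply/asboolP.
  exists (k' + k)%N, (l + l')%N.
  by rewrite iterD e -iterD addnC iterD e' -iterD.
Qed.

Canonical colim_equiv := EquivRelPack colim_rel_equiv.
Canonical colim_encModRel := defaultEncModRel colim_rel.

Definition colim : Type := {eq_quot colim_rel}.

HB.instance Definition _ := Choice.on colim.

Definition colim_in (i : nat) (x : R i) : colim :=
  \pi_({eq_quot colim_rel}) (existT _ i x : T).

Lemma colim_inP i j (x : R i) (y : R j) :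
  colim_in x = colim_in y <->
  exists k l, iter k colim_step (existT _ i x) = iter l colim_step (existT _ j y).
Proof.
rewrite /colim_in; split=> [/eqP|h].
  by rewrite piE => /asboolP.
by apply/eqP; rewrite piE; apply/asboolP.
Qed.

Lemma colim_in_step i (x : R i) : colim_in (t i x) = colim_in x.
Proof. by apply/colim_inP; exists 0, 1. Qed.

Fixpoint colim_lift k i (x : R i) : R (k + i) :=
  if k is k'.+1 then t (k' + i) (colim_lift k' x) else x.

Lemma iter_colim_step k i (x : R i) :
  iter k colim_step (existT _ i x) = existT _ (k + i)%N (colim_lift k x).
Proof. by elim: k => //= k ->. Qed.

Lemma colim_in_lift k i (x : R i) : colim_in (colim_lift k x) = colim_in x.
Proof. by elim: k => //= k IH; rewrite colim_in_step. Qed.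

Lemma colim_in_eqP i (x y : R i) : 
  colim_in x = colim_in y <-> exists k, colim_lift k x = colim_lift k y.
Proof.
split=> [/colim_inP[k [l]]|[k e]].
  rewrite !iter_colim_step => e.
  have ekl : k = l by move: (congr1 (@tag _ _) e) => /= /addIn.
  by subst l; exists k; exact: eq_from_Tagged e.
by rewrite -(colim_in_lift k x) e colim_in_lift.
Qed.

Lemma colim_lift_is_zmod k i : zmod_morphism (@colim_lift k i).
Proof. by move=> x y; elim: k => //= k ->; rewrite raddfB. Qed.
Lemma colim_lift_is_monoid k i : monoid_morphism (@colim_lift k i).
Proof.
split=> [|x y]; first by elim: k => //= k ->; rewrite rmorph1.
by elim: k => //= k ->; rewrite rmorphM.
Qed.
HB.instance Definition _ k i :=
  GRing.isZmodMorphism.Build (R i) (R (k + i)) (@colim_lift k i)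
    (@colim_lift_is_zmod k i).
HB.instance Definition _ k i :=
  GRing.isMonoidMorphism.Build (R i) (R (k + i)) (@colim_lift k i)
    (@colim_lift_is_monoid k i).

Lemma colim_inK (u : colim) : exists i, exists x : R i, u = colim_in x.
Proof.
exists (tag (repr (u : {eq_quot colim_rel}))), (tagged (repr (u : {eq_quot colim_rel}))).
rewrite /colim_in -[LHS](reprK (u : {eq_quot colim_rel})).
by case: (repr _).
Qed.

Lemma colim_ge n i (x : R i) : (i <= n)%N -> exists y : R n, colim_in x = colim_in y.
Proof.
move=> /subnK <-; exists (colim_lift (n - i) x); by rewrite colim_in_lift.
Qed.

Lemma colim_common3 (u v w : colim) : exists n, exists x y z : R n,
  [/\ u = colim_in x, v = colim_in y & w = colim_in z].
Proof.
have [i [x ->]] := colim_inK u; have [j [y ->]] := colim_inK v.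
have [k [z ->]] := colim_inK w.
exists (i + j + k)%N.
have [|x' ->] := @colim_ge (i + j + k) i x; first by rewrite -addnA leq_addr.
have [|y' ->] := @colim_ge (i + j + k) j y.
  by rewrite addnAC leq_addl.
have [|z' ->] := @colim_ge (i + j + k) k z; first by rewrite leq_addl.
by exists x', y', z'.
Qed.

Lemma colim_common (u v : colim) :
  {n & {xy : R n * R n | u = colim_in xy.1 /\ v = colim_in xy.2}}.
Proof.
have h : exists n, exists xy : R n * R n, u = colim_in xy.1 /\ v = colim_in xy.2.
  by have [n [x [y [_ [-> -> _]]]]] := colim_common3 u v u; exists n, (x, y).
by have [n /cid h'] := cid h; exists n.
Qed.

(* Lift both arguments to a common stage and operate there. *)
Definition colim_op (op : forall n, R n -> R n -> R n) (u v : colim) : colim :=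
  let: existT n (exist xy _) := colim_common u v in colim_in (op n xy.1 xy.2).

Lemma colim_opE (op : forall n, R n -> R n -> R n) :
    (forall n (x y : R n), t n (op n x y) = op n.+1 (t n x) (t n y)) ->
  forall n (x y : R n),
  colim_op op (colim_in x) (colim_in y) = colim_in (op n x y).
Proof.
move=> opt n x y; rewrite /colim_op.
case: colim_common => m [[x' y'] /= [ex ey]].
have lop k i (a b : R i) :
    colim_lift k (op i a b) = op _ (colim_lift k a) (colim_lift k b).
  by elim: k => //= k ->; rewrite opt.
have [N [f [g [f1 g1 f2 g2]]]] : exists N (f : R n -> R N) (g : R m -> R N),
  [/\ forall a, colim_in (f a) = colim_in a,
      forall a, colim_in (g a) = colim_in a,
      forall a b, f (op n a b) = op N (f a) (f b) &
      forall a b, g (op m a b) = op N (g a) (g b)].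
  have ex_lift i : (i <= maxn n m)%N -> exists f : R i -> R (maxn n m),
      (forall a, colim_in (f a) = colim_in a) /\
      forall a b, f (op i a b) = op _ (f a) (f b).
    move=> /subnK <-; exists (@colim_lift _ i).
    by split=> [a|a b]; [exact: colim_in_lift|exact: lop].
  have [f [f1 f2]] := ex_lift n (leq_maxl n m).
  have [g [g1 g2]] := ex_lift m (leq_maxr n m).
  by exists (maxn n m), f, g.
have /colim_in_eqP[k ek] : colim_in (g x') = colim_in (f x) by rewrite f1 g1.
have /colim_in_eqP[l el] : colim_in (g y') = colim_in (f y) by rewrite f1 g1.
have lift_le k' K i (a b : R i) : (k' <= K)%N ->
    colim_lift k' a = colim_lift k' b -> colim_lift K a = colim_lift K b.
  by move=> /subnK <- e; elim: (K - k')%N => //= d ->.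
rewrite -g1 g2 -f1 f2; apply/colim_in_eqP; exists (k + l)%N; rewrite !lop.
congr (op _ _ _); first exact: lift_le (leq_addr l k) _.
exact: lift_le (leq_addl k l) _.
Qed.

Definition colim_add := colim_op (fun n => +%R).
Definition colim_mul := colim_op (fun n => *%R).
Definition colim_zero := colim_in (0 : R 0%N).
Definition colim_one := colim_in (1 : R 0%N).
Definition colim_opp (u : colim) : colim := colim_mul (colim_in (- 1 : R 0%N)) u.

Lemma colim_addE n (x y : R n) :
  colim_add (colim_in x) (colim_in y) = colim_in (x + y).
Proof. by apply: (colim_opE (op := fun n => +%R)) => *; rewrite rmorphD. Qed.

Lemma colim_mulE n (x y : R n) :
  colim_mul (colim_in x) (colim_in y) = colim_in (x * y).
Proof. by apply: (colim_opE (op := fun n => *%R)) => *; rewrite rmorphM. Qed.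

Lemma colim_zeroE n : colim_zero = colim_in (0 : R n).
Proof. by elim: n => // n ->; rewrite -colim_in_step rmorph0. Qed.
Lemma colim_oneE n : colim_one = colim_in (1 : R n).
Proof. by elim: n => // n ->; rewrite -colim_in_step rmorph1. Qed.
Lemma colim_oppE n (x : R n) : colim_opp (colim_in x) = colim_in (- x).
Proof.
rewrite /colim_opp; have -> : colim_in (- 1 : R 0) = colim_in (- 1 : R n).
  by elim: n {x} => // n ->; rewrite -colim_in_step rmorphN1.
by rewrite colim_mulE mulN1r.
Qed.

Lemma colim_addA : associative colim_add.
Proof.
move=> u v w; have [n [x [y [z [-> -> ->]]]]] := colim_common3 u v w.
by rewrite !colim_addE addrA.
Qed.
Lemma colim_addC : commutative colim_add.
Proof.
move=> u v; have [n [x [y [z [-> -> _]]]]] := colim_common3 u v u.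
by rewrite !colim_addE addrC.
Qed.
Lemma colim_add0 : left_id colim_zero colim_add.
Proof.
move=> u; have [n [x ->]] := colim_inK u.
by rewrite (colim_zeroE n) colim_addE add0r.
Qed.
Lemma colim_addN : left_inverse colim_zero colim_opp colim_add.
Proof.
move=> u; have [n [x ->]] := colim_inK u.
by rewrite (colim_zeroE n) colim_oppE colim_addE addNr.
Qed.
Lemma colim_mulA : associative colim_mul.
Proof.
move=> u v w; have [n [x [y [z [-> -> ->]]]]] := colim_common3 u v w.
by rewrite !colim_mulE mulrA.
Qed.
Lemma colim_mulC : commutative colim_mul.
Proof.
move=> u v; have [n [x [y [z [-> -> _]]]]] := colim_common3 u v u.
by rewrite !colim_mulE mulrC.
Qed.
Lemma colim_mul1 : left_id colim_one colim_mul.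
Proof.
move=> u; have [n [x ->]] := colim_inK u.
by rewrite (colim_oneE n) colim_mulE mul1r.
Qed.
Lemma colim_mulDl : left_distributive colim_mul colim_add.
Proof.
move=> u v w; have [n [x [y [z [-> -> ->]]]]] := colim_common3 u v w.
by rewrite !(colim_mulE, colim_addE) mulrDl.
Qed.

HB.instance Definition _ := GRing.isZmodule.Build colim
  colim_addA colim_addC colim_add0 colim_addN.
HB.instance Definition _ := GRing.Zmodule_isComPzRing.Build colim
  colim_mulA colim_mulC colim_mul1 colim_mulDl.

Lemma colim_in_is_zmod i : zmod_morphism (@colim_in i).
Proof.
by move=> x y; rewrite -colim_addE -colim_oppE.
Qed.
Lemma colim_in_is_monoid i : monoid_morphism (@colim_in i).
Proof. by split=> [|x y]; [rewrite -colim_oneE|rewrite -colim_mulE]. Qed.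
HB.instance Definition _ i := GRing.isZmodMorphism.Build (R i) colim
  (@colim_in i) (@colim_in_is_zmod i).
HB.instance Definition _ i := GRing.isMonoidMorphism.Build (R i) colim
  (@colim_in i) (@colim_in_is_monoid i).

End DirectedColimit.

Section Frobenius.
Variables (p : nat) (pr : prime p) (A : comPzRingType).
Hypothesis pA0 : p%:R = 0 :> A.

Lemma expr_prime_char_add (x y : A) : (x + y) ^+ p = x ^+ p + y ^+ p.
Proof.
have defp := prednK (prime_gt0 pr).
rewrite exprDn big_ord_recr subnn -defp big_ord_recl /= defp.
rewrite subn0 mulr1 mul1r bin0 binn big1 ?addr0 // => i _.
have /dvdnP[q ->] : (p %| 'C(p, bump 0 i))%N.
  by apply: prime_dvd_bin => //=; rewrite -{2}defp ltnS (valP i).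
by rewrite -mulr_natr natrM pA0 !mulr0.
Qed.

Lemma expr_prime_char_sub (x y : A) : (x - y) ^+ p = x ^+ p - y ^+ p.
Proof. by apply/(addIr (y ^+ p)); rewrite -expr_prime_char_add !subrK. Qed.

End Frobenius.

Local Notation "1" := (@mone _) : monom_scope.
Local Notation "x * y" := (mmul x y) : monom_scope.

Notation ipoly I := {malg int[{cmonom I}]}.

Section IntegralPolynomials.
Variable I : choiceType.

Definition ivar (i : I) : (ipoly I) := mkmalgU (@ucm I i) 1.

Section Eval.
Variables (A : comPzRingType) (h : I -> A).

Definition meval (m : cmonom I) : A := \prod_(i <- finsupp m) h i ^+ m i.

Definition ieval (g : (ipoly I)) : A := \sum_(m <- msupp g) meval m *~ g@_m.

Lemma mevalEw (m : cmonom I) (d : {fset I}) : (finsupp m `<=` d)%fset ->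
  meval m = \prod_(i <- d) h i ^+ m i.
Proof.
move=> le; rewrite /meval (big_fset_incl _ le) // => i _.
by rewrite -cmE_neq0 negbK => /eqP ->.
Qed.

Lemma meval1 : meval 1%M = 1.
Proof. by rewrite /meval mdom1 big_seq_fset0. Qed.

Lemma mevalM m1 m2 : meval (m1 * m2)%M = meval m1 * meval m2.
Proof.
rewrite [LHS]/meval mdomD (mevalEw (fsubsetUl _ (finsupp m2))).
rewrite (mevalEw (fsubsetUr (finsupp m1) _)) -big_split /=.
by apply: eq_bigr => i _; rewrite cmM exprD.
Qed.

Lemma mevalU i : meval (ucm i) = h i.
Proof. by rewrite /meval mdomU big_seq_fset1 cmUU expr1. Qed.

Lemma ievalEw (d : {fset cmonom I}) (g : (ipoly I)) : (msupp g `<=` d)%fset ->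
  ieval g = \sum_(m <- d) meval m *~ g@_m.
Proof.
move=> le; rewrite /ieval (big_fset_incl _ le) // => m _ /mcoeff_outdom ->.
by rewrite mulr0z.
Qed.

Lemma ievalU c m : ieval (mkmalgU m c) = meval m *~ c.
Proof. by rewrite (ievalEw msuppU_le) big_seq_fset1 mcoeffUU. Qed.

Lemma ieval_is_zmod : zmod_morphism ieval.
Proof.
move=> g1 g2; set d := (msupp g1 `|` msupp g2)%fset.
rewrite (@ievalEw d (g1 - g2)) ?(@ievalEw d g1) ?(@ievalEw d g2).
- rewrite -sumrB; apply: eq_bigr => m _; rewrite mcoeffB.
  by rewrite mulrzBr.
- exact: fsubsetUr.
- exact: fsubsetUl.
- exact: msuppB_le.
Qed.

HB.instance Definition _ :=
  GRing.isZmodMorphism.Build (ipoly I) A ieval ieval_is_zmod.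

Lemma ieval_is_monoid : monoid_morphism ieval.
Proof.
split=> [|g1 g2].
  by rewrite [X in ieval X](_ : _ = mkmalgU 1%M 1) // ievalU meval1.
rewrite [X in ieval X](malgME g1 g2) raddf_sum [ieval g1]/ieval [ieval g2]/ieval mulr_suml.
apply: eq_bigr => m _; rewrite raddf_sum mulr_sumr; apply: eq_bigr => m' _.
by rewrite /= ievalU mevalM -mulrzr intrM -[in RHS]mulrzr -[X in _ = _ * X]mulrzr; ring.
Qed.

HB.instance Definition _ :=
  GRing.isMonoidMorphism.Build (ipoly I) A ieval ieval_is_monoid.

Lemma ieval_ivar i : ieval (ivar i) = h i.
Proof. by rewrite ievalU mevalU mulr1z. Qed.

End Eval.

Lemma cmonom_ind (P : cmonom I -> Prop) :
  P 1%M -> (forall i m, P m -> P (ucm i * m)%M) -> forall m, P m.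
Proof.
move=> P1 PU m; have [n] := ubnP (mdeg m); elim: n m => // n IH m.
rewrite ltnS => hm; case: (fset_0Vmem (finsupp m)) => [m0|[i im]].
  suff -> : m = 1%M by [].
  by apply: mdeg_eq0I; rewrite mdegE m0 big_seq_fset0.
have e : m = (ucm i * divcm m (ucm i))%M.
  apply/eqP/cmP => j; rewrite cmM divcmE cmU.
  case: eqP => [<-|_]; last by rewrite add0n subn0.
  by rewrite subnKC // lt0n cmE_neq0.
rewrite e; apply: PU; apply: IH; apply: leq_trans hm.
by rewrite [X in (_ < mdeg X)%N]e mdegM mdegU.
Qed.

Lemma ipoly_hom_eq (A : comPzRingType) (f g : {rmorphism (ipoly I) -> A}) :
  (forall i, f (ivar i) = g (ivar i)) -> f =1 g.
Proof.
move=> fg; have fg_monom m : f (mkmalgU m 1) = g (mkmalgU m 1).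
  elim/cmonom_ind: m => [|i m IH].
    exact: etrans (rmorph1 f) (esym (rmorph1 g)).
  have -> : mkmalgU (ucm i * m)%M 1 = ivar i * mkmalgU m 1 :> ipoly I.
    by rewrite malgM_def fgmulUU mulr1.
  apply: etrans (rmorphM f _ _) (etrans _ (esym (rmorphM g _ _))).
  exact: (congr2 *%R (fg i) IH).
move=> x; rewrite (monalgE x) !raddf_sum; apply: eq_bigr => m _.
have -> c : mkmalgU m c = (mkmalgU m 1 : (ipoly I)) *~ c.
  by rewrite -[in LHS](intz c) raddfMz.
apply: etrans (raddfMz f _ _) (etrans _ (esym (raddfMz g _ _))).
exact: (congr1 (fun z => z *~ _) (fg_monom m)).
Qed.

Lemma ieval_comp (A B : comPzRingType) (f : {rmorphism A -> B}) (h : I -> A) g :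
  f (ieval h g) = ieval (f \o h) g.
Proof.
apply: (@ipoly_hom_eq B (f \o ieval h) (ieval (f \o h))) => i /=.
by rewrite !ieval_ivar.
Qed.

Lemma ieval_id g : ieval ivar g = g.
Proof.
by apply: (@ipoly_hom_eq (ipoly I) (ieval ivar) idfun) => i /=; rewrite ieval_ivar.
Qed.

Lemma ipoly_torsion_free n (g : (ipoly I)) : (0 < n)%N -> n%:R * g = 0 -> g = 0.
Proof.
move=> n0 h; apply/malgP => m; move: (congr1 (mcoeff m) h).
rewrite mulr_natl [LHS](raddfMn (mcoeff m)) [RHS]mcoeff0 mcoeff0.
by move/eqP; rewrite mulrn_eq0 => /orP[|/eqP//]; rewrite eqn0Ngt n0.
Qed.

End IntegralPolynomials.

Definition mod_p (p : nat) (S : comPzRingType) :=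
  quotient (principal_ideal (p%:R : S)).

HB.instance Definition _ p S := GRing.ComPzRing.on (mod_p p S).

Definition frobenius_mod_p (p : nat) (_ : prime p) (S : comPzRingType)
  (x : mod_p p S) : mod_p p S := x ^+ p.

Section FrobeniusModP.
Variables (p : nat) (pr : prime p) (S : comPzRingType).

Local Notation mod_p := (mod_p p S).
Local Notation frobenius_mod_p := (@frobenius_mod_p p pr S).

Lemma natr_mod_p : p%:R = 0 :> mod_p.
Proof.
rewrite -(rmorph_nat (quot_proj (principal_ideal (p%:R : S)))).
rewrite -(rmorph0 (quot_proj (principal_ideal (p%:R : S)))).
by apply/quot_projP; rewrite subr0; apply: sub_ideal_gen.
Qed.

Lemma frobenius_mod_p_is_zmod : zmod_morphism frobenius_mod_p.
Proof. by move=> x y; apply: expr_prime_char_sub => //; exact: natr_mod_p. Qed.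

Lemma frobenius_mod_p_is_monoid : monoid_morphism frobenius_mod_p.
Proof. by split=> [|x y]; [exact: expr1n|exact: exprMn]. Qed.

HB.instance Definition _ := GRing.isZmodMorphism.Build mod_p mod_p
  frobenius_mod_p frobenius_mod_p_is_zmod.
HB.instance Definition _ := GRing.isMonoidMorphism.Build mod_p mod_p
  frobenius_mod_p frobenius_mod_p_is_monoid.

End FrobeniusModP.

Section Divisibility.
Variables (p : nat) (pr : prime p) (A : comPzRingType).

Definition pdvd n (x : A) := exists y, x = p%:R ^+ n * y.

Lemma pdvd0 n : pdvd n 0.
Proof. by exists 0; rewrite mulr0. Qed.

Lemma pdvdD n x y : pdvd n x -> pdvd n y -> pdvd n (x + y).
Proof. by move=> [a ->] [b ->]; exists (a + b); rewrite mulrDr. Qed.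

Lemma pdvdM n a x : pdvd n x -> pdvd n (a * x).
Proof. by move=> [b ->]; exists (a * b); rewrite mulrCA. Qed.

Lemma pdvd_sum n m (F : 'I_m -> A) :
  (forall i, pdvd n (F i)) -> pdvd n (\sum_i F i).
Proof. by move=> h; elim/big_ind: _ => //; [exact: pdvd0|exact: pdvdD]. Qed.

Lemma pdvd_subX n x y k : pdvd n (x - y) -> pdvd n (x ^+ k - y ^+ k).
Proof. by rewrite subrXX mulrC => h; apply: pdvdM. Qed.

Lemma pdvd_lift n x y :
  pdvd n.+1 (x - y) -> pdvd n.+2 (x ^+ p - y ^+ p).
Proof.
move=> h; rewrite subrXX.
have [z ->] : pdvd 1 (\sum_(i < p) x ^+ (p.-1 - i) * y ^+ i).
  have -> : \sum_(i < p) x ^+ (p.-1 - i) * y ^+ i =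
      \sum_(i < p) y ^+ i * (x ^+ (p.-1 - i) - y ^+ (p.-1 - i)) +
      p%:R ^+ 1 * y ^+ p.-1.
    rewrite expr1 mulr_natl -[in _ *+ p](card_ord p) -sumr_const -big_split /=.
    apply: eq_bigr => i _; rewrite mulrBr -exprD subnKC; last first.
      by rewrite -ltnS prednK ?prime_gt0.
    by rewrite card_ord subrK mulrC.
  apply: pdvdD; last by exists (y ^+ p.-1).
  apply: pdvd_sum => i; apply/pdvdM/pdvd_subX.
  by case: h => w ->; exists (p%:R ^+ n * w); rewrite exprS expr1 mulrA.
case: h => w ->; exists (w * z); rewrite -[n.+2]addn1 exprD.
by rewrite mulrACA.
Qed.

Lemma pdvd_lift_iter n x y :
  pdvd 1 (x - y) -> pdvd n.+1 (x ^+ (p ^ n) - y ^+ (p ^ n)).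
Proof.
move=> h; elim: n => [|n IH]; first by rewrite expn0 !expr1.
by rewrite expnSr !exprM; apply: pdvd_lift.
Qed.

End Divisibility.

Section Ghost.
Variable p : nat.

Definition ghost (A : comPzRingType) (a : nat -> A) n : A :=
  \sum_(k < n.+1) p%:R ^+ k * a k ^+ (p ^ (n - k)).

Lemma ghost_map (A B : comPzRingType) (f : {rmorphism A -> B}) a n :
  f (ghost a n) = ghost (f \o a) n.
Proof.
rewrite /ghost rmorph_sum; apply: eq_bigr => k _.
by rewrite rmorphM !rmorphXn rmorph_nat.
Qed.

Lemma ghost_rec (A : comPzRingType) (a : nat -> A) n :
  ghost a n = \sum_(k < n) p%:R ^+ k * a k ^+ (p ^ (n - k)) + p%:R ^+ n * a n.
Proof. by rewrite /ghost big_ord_recr /= subnn expn0 expr1. Qed.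

End Ghost.

Section Dwork.
Variables (p : nat) (pr : prime p) (A : comPzRingType).

Definition pquo n (x : A) : A := xget 0 [set y | x = p%:R ^+ n * y].

Lemma pquoP n x : pdvd p n x -> x = p%:R ^+ n * pquo n x.
Proof. by move=> h; apply: (xgetPex 0 h). Qed.

(* [wcoord z] is the only candidate for a Witt vector with ghost components z:
   its n-th entry is (z_n - sum_(k < n) p^k a_k^(p^(n-k))) / p^n. *)
Fixpoint wcoords (z : nat -> A) n : seq A :=
  if n is n'.+1 then
    let s := wcoords z n' in
    rcons s (pquo n' (z n' - \sum_(k < n') p%:R ^+ k * s`_k ^+ (p ^ (n' - k))))
  else [::].

Definition wcoord z n : A := (wcoords z n.+1)`_n.

Lemma size_wcoords z n : size (wcoords z n) = n.
Proof. by elim: n => //= n IH; rewrite size_rcons IH. Qed.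

Lemma nth_wcoords z n k : (k < n)%N -> (wcoords z n)`_k = wcoord z k.
Proof.
move=> /subnK <-; elim: (n - k.+1)%N => //= d IH.
by rewrite nth_rcons size_wcoords addnS ltnS leq_addl -addnS IH.
Qed.

Lemma wcoordE z n : wcoord z n =
  pquo n (z n - \sum_(k < n) p%:R ^+ k * wcoord z k ^+ (p ^ (n - k))).
Proof.
rewrite {1}/wcoord /= nth_rcons size_wcoords ltnn eqxx; congr (pquo n (_ - _)).
by apply: eq_bigr => k _; rewrite nth_wcoords.
Qed.

Lemma ghost_inj : (forall n (x y : A), p%:R ^+ n * x = p%:R ^+ n * y -> x = y) ->
  forall a b : nat -> A, (forall n, ghost p a n = ghost p b n) ->
  forall n, a n = b n.
Proof.
move=> reg a b e n; elim/ltn_ind: n => n IH; have := e n; rewrite !ghost_rec.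
rewrite (eq_bigr (fun k : 'I_n => p%:R ^+ k * b k ^+ (p ^ (n - k)))).
  by move=> /addrI; exact: reg.
by move=> k _; rewrite IH.
Qed.

Variable phi : {rmorphism A -> A}.

(* Dwork's lemma: for a lift phi of Frobenius, z is a sequence of ghost
   components as soon as z_(n+1) = phi z_n modulo p^(n+1). *)
Definition dwork (z : nat -> A) :=
  forall n, pdvd p n.+1 (z n.+1 - phi (z n)).

Hypothesis phiP : forall x, pdvd p 1 (phi x - x ^+ p).

Lemma ghost_wcoord z : dwork z -> forall n, ghost p (wcoord z) n = z n.
Proof.
move=> dz; elim=> [|n IH]; rewrite ghost_rec [in X in _ + X]wcoordE -pquoP ?subrKC//.
  by rewrite big_ord0 subr0; exists (z 0%N); rewrite expr0 mul1r.
have [y e] := dz n; rewrite -(subrK (phi (z n)) (z n.+1)) e -addrA.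
apply: pdvdD; first by exists y.
rewrite -IH /ghost rmorph_sum -sumrB; apply: pdvd_sum => k.
rewrite rmorphM !rmorphXn rmorph_nat -mulrBr.
have kn : (k <= n)%N by rewrite -ltnS.
rewrite subSn// expnS exprM.
have [w ->] := pdvd_lift_iter pr (n - k) (phiP (wcoord z k)).
by exists w; rewrite mulrA -exprD addnS subnKC.
Qed.

Lemma dworkD z z' : dwork z -> dwork z' -> dwork (fun n => z n + z' n).
Proof. by move=> dz dz' n; rewrite rmorphD opprD addrACA; apply: pdvdD. Qed.

Lemma dworkM z z' : dwork z -> dwork z' -> dwork (fun n => z n * z' n).
Proof.
move=> dz dz' n; rewrite rmorphM.
rewrite -(subrKA (z n.+1 * phi (z' n))) -mulrBl -mulrBr.
by apply: pdvdD; [apply: pdvdM|rewrite mulrC; apply: pdvdM].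
Qed.

Lemma dworkN z : dwork z -> dwork (fun n => - z n).
Proof.
by move=> dz n; rewrite rmorphN; move: (pdvdM (- 1) (dz n)); rewrite mulN1r opprD.
Qed.

Lemma dwork_ghost (a : nat -> A) :
  (forall n, phi (a n) = a n ^+ p) -> dwork (ghost p a).
Proof.
move=> ha n; rewrite ghost_rec addrAC ghost_map.
apply: pdvdD; last by exists (a n.+1).
rewrite /ghost -sumrB; apply: pdvd_sum => k.
rewrite /= ha -exprM -expnS -subSn ?subrr -1?ltnS//.
exact: pdvd0.
Qed.

End Dwork.

Section WittPolynomials.
Variables (p : nat) (pr : prime p).

Local Notation Pol := (ipoly (nat * nat)%type).

Lemma natrX_ipoly_inj n (x y : Pol) :
  p%:R ^+ n * x = p%:R ^+ n * y -> x = y.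
Proof.
move=> e; apply/subr0_eq/(@ipoly_torsion_free _ (p ^ n)).
  by rewrite expn_gt0 prime_gt0.
by rewrite natrX mulrBr e subrr.
Qed.

Definition frob_lift : {rmorphism Pol -> Pol} := ieval (fun i => ivar i ^+ p).

Lemma frob_lift_ivar i : frob_lift (ivar i) = ivar i ^+ p.
Proof. exact: ieval_ivar. Qed.

Lemma frob_liftP (x : Pol) : pdvd p 1 (frob_lift x - x ^+ p).
Proof.
pose pi : {rmorphism Pol -> mod_p p Pol} := quot_proj (principal_ideal (p%:R : Pol)).
pose fr : {rmorphism mod_p p Pol -> mod_p p Pol} := @frobenius_mod_p p pr Pol.
have e : pi (frob_lift x) = pi (x ^+ p).
  apply: etrans (esym (rmorphXn pi p x)).
  apply: (ipoly_hom_eq (f := pi \o frob_lift) (g := fr \o pi)) => i.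
  apply: etrans (congr1 pi (frob_lift_ivar i)) _; exact: rmorphXn.
have /principal_idealP[r ->] := (quot_projP _ _ _).1 e.
by exists r; rewrite expr1 mulrC.
Qed.

(* The universal Witt polynomials, in the variables X_n = wvar 0 n and
   Y_n = wvar 1 n, are determined by their ghost components ([ghost_inj]). *)
Definition wvar j n : Pol := ivar (j, n).

Lemma dwork_wvar j : dwork p frob_lift (ghost p (wvar j)).
Proof. apply: dwork_ghost => n; exact: frob_lift_ivar. Qed.

Lemma witt_add_pol_subproof : {S : nat -> Pol |
  forall n, ghost p S n = ghost p (wvar 0) n + ghost p (wvar 1) n}.
Proof.
exists (wcoord p (fun n => ghost p (wvar 0) n + ghost p (wvar 1) n)).
apply: (ghost_wcoord pr frob_liftP (dworkD _ _)); exact: dwork_wvar.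
Qed.

Lemma witt_mul_pol_subproof : {S : nat -> Pol |
  forall n, ghost p S n = ghost p (wvar 0) n * ghost p (wvar 1) n}.
Proof.
exists (wcoord p (fun n => ghost p (wvar 0) n * ghost p (wvar 1) n)).
apply: (ghost_wcoord pr frob_liftP (dworkM _ _)); exact: dwork_wvar.
Qed.

Lemma witt_opp_pol_subproof : {S : nat -> Pol |
  forall n, ghost p S n = - ghost p (wvar 0) n}.
Proof.
exists (wcoord p (fun n => - ghost p (wvar 0) n)).
apply: (ghost_wcoord pr frob_liftP (dworkN _)); exact: dwork_wvar.
Qed.

Definition witt_add_pol := sval witt_add_pol_subproof.
Definition witt_mul_pol := sval witt_mul_pol_subproof.
Definition witt_opp_pol := sval witt_opp_pol_subproof.

End WittPolynomials.

(* p-typical Witt vectors; sum, product and opposite are the universal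
   polynomials evaluated at the coordinates. *)
Record witt (p : nat) (pr : prime p) (A : comPzRingType) :=
  Witt { witt_coef :> nat -> A }.

Section WittRing.
Variables (p : nat) (pr : prime p).

Local Notation Pol := (ipoly (nat * nat)%type).

Section Operations.
Variable A : comPzRingType.
Local Notation W := (witt pr A).

HB.instance Definition _ := gen_eqMixin W.
HB.instance Definition _ := gen_choiceMixin W.

Lemma witt_ext (a b : W) : (forall n, a n = b n) -> a = b.
Proof. by case: a b => a [b] /= e; congr Witt; apply: functional_extensionality_dep. Qed.

Definition witt_env (a b : W) (jn : nat * nat) : A :=
  if jn.1 is 0%N then a jn.2 else b jn.2.

Definition witt_zero : W := Witt pr (fun=> 0).
Definition witt_one : W := Witt pr (fun n => (n == 0%N)%:R).
Definition witt_opp (a : W) : W :=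
  Witt pr (fun n => ieval (witt_env a a) (witt_opp_pol pr n)).
Definition witt_add (a b : W) : W :=
  Witt pr (fun n => ieval (witt_env a b) (witt_add_pol pr n)).
Definition witt_mul (a b : W) : W :=
  Witt pr (fun n => ieval (witt_env a b) (witt_mul_pol pr n)).

Lemma ghost_ieval_wvar0 (a b : W) n :
  ieval (witt_env a b) (ghost p (wvar 0) n) = ghost p a n.
Proof.
rewrite ghost_map; apply: eq_bigr => k _; congr (_ * _ ^+ _).
exact: ieval_ivar.
Qed.

Lemma ghost_ieval_wvar1 (a b : W) n :
  ieval (witt_env a b) (ghost p (wvar 1) n) = ghost p b n.
Proof.
rewrite ghost_map; apply: eq_bigr => k _; congr (_ * _ ^+ _).
exact: ieval_ivar.
Qed.

Lemma ghost_add (a b : W) n :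
  ghost p (witt_add a b) n = ghost p a n + ghost p b n.
Proof.
rewrite -(ghost_ieval_wvar0 a b) -(ghost_ieval_wvar1 a b) -rmorphD.
rewrite -(svalP (witt_add_pol_subproof pr)) ghost_map; exact: eq_bigr.
Qed.

Lemma ghost_mul (a b : W) n :
  ghost p (witt_mul a b) n = ghost p a n * ghost p b n.
Proof.
rewrite -(ghost_ieval_wvar0 a b) -(ghost_ieval_wvar1 a b) -rmorphM.
rewrite -(svalP (witt_mul_pol_subproof pr)) ghost_map; exact: eq_bigr.
Qed.

Lemma ghost_opp (a : W) n : ghost p (witt_opp a) n = - ghost p a n.
Proof.
rewrite -(ghost_ieval_wvar0 a a) -rmorphN.
rewrite -(svalP (witt_opp_pol_subproof pr)) ghost_map; exact: eq_bigr.
Qed.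

Lemma ghost_zero n : ghost p witt_zero n = 0.
Proof.
apply: big1 => k _; rewrite /= expr0n expn_eq0.
by rewrite eqn0Ngt prime_gt0 //= mulr0.
Qed.

Lemma ghost_one n : ghost p witt_one n = 1.
Proof.
rewrite /ghost big_ord_recl /= expr0 mul1r expr1n big1 ?addr0 // => k _.
by rewrite /= expr0n expn_eq0 eqn0Ngt prime_gt0 //= mulr0.
Qed.

End Operations.

(* The ring axioms hold when the ghost map is injective, and are transported
   along a morphism from a polynomial ring in general. *)
Section GhostInjective.
Variable B : comPzRingType.
Hypothesis reg : forall n (x y : B), p%:R ^+ n * x = p%:R ^+ n * y -> x = y.
Implicit Types u v w : witt pr B.

Lemma witt_ghost_ext u v : (forall n, ghost p u n = ghost p v n) -> u = v.
Proof. by move=> e; apply/witt_ext/(ghost_inj reg e). Qed.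

Lemma witt_reg_addA u v w :
  witt_add u (witt_add v w) = witt_add (witt_add u v) w.
Proof. by apply: witt_ghost_ext => n; rewrite !ghost_add addrA. Qed.
Lemma witt_reg_addC u v : witt_add u v = witt_add v u.
Proof. by apply: witt_ghost_ext => n; rewrite !ghost_add addrC. Qed.
Lemma witt_reg_add0 u : witt_add (witt_zero B) u = u.
Proof. by apply: witt_ghost_ext => n; rewrite ghost_add ghost_zero add0r. Qed.
Lemma witt_reg_addN u : witt_add (witt_opp u) u = witt_zero B.
Proof.
by apply: witt_ghost_ext => n; rewrite ghost_add ghost_opp ghost_zero addNr.
Qed.
Lemma witt_reg_mulA u v w :
  witt_mul u (witt_mul v w) = witt_mul (witt_mul u v) w.
Proof. by apply: witt_ghost_ext => n; rewrite !ghost_mul mulrA. Qed.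
Lemma witt_reg_mulC u v : witt_mul u v = witt_mul v u.
Proof. by apply: witt_ghost_ext => n; rewrite !ghost_mul mulrC. Qed.
Lemma witt_reg_mul1 u : witt_mul (witt_one B) u = u.
Proof. by apply: witt_ghost_ext => n; rewrite ghost_mul ghost_one mul1r. Qed.
Lemma witt_reg_mulDl u v w :
  witt_mul (witt_add u v) w = witt_add (witt_mul u w) (witt_mul v w).
Proof.
by apply: witt_ghost_ext => n; rewrite !(ghost_add, ghost_mul) mulrDl.
Qed.

End GhostInjective.

Definition witt_map (A B : comPzRingType) (f : A -> B) (a : witt pr A) :
  witt pr B := Witt pr (fun n => f (a n)).

Section Naturality.
Variables (A B : comPzRingType) (f : {rmorphism A -> B}).

Lemma witt_map_ieval (a b : witt pr A) g :
  f (ieval (witt_env a b) g) = ieval (witt_env (witt_map f a) (witt_map f b)) g.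
Proof.
rewrite ieval_comp; congr ieval; apply: functional_extensionality_dep => -[j n].
by rewrite /witt_env /=; case: j.
Qed.

Lemma witt_map_add (a b : witt pr A) :
  witt_map f (witt_add a b) = witt_add (witt_map f a) (witt_map f b).
Proof. by apply: witt_ext => n; apply: witt_map_ieval. Qed.

Lemma witt_map_mul (a b : witt pr A) :
  witt_map f (witt_mul a b) = witt_mul (witt_map f a) (witt_map f b).
Proof. by apply: witt_ext => n; apply: witt_map_ieval. Qed.

Lemma witt_map_opp (a : witt pr A) :
  witt_map f (witt_opp a) = witt_opp (witt_map f a).
Proof. by apply: witt_ext => n; apply: witt_map_ieval. Qed.

Lemma witt_map_zero : witt_map f (witt_zero A) = witt_zero B.
Proof. by apply: witt_ext => n; apply: rmorph0. Qed.

Lemma witt_map_one : witt_map f (witt_one A) = witt_one B.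
Proof. by apply: witt_ext => n; apply: rmorph_nat. Qed.

End Naturality.

Section RingLaws.
Variable A : comPzRingType.
Local Notation W := (witt pr A).

Lemma witt_lift3 (a b c : W) :
  exists (f : {rmorphism Pol -> A}) (u v w : witt pr Pol),
  [/\ a = witt_map f u, b = witt_map f v & c = witt_map f w].
Proof.
pose h (jn : nat * nat) := nth (c : nat -> A) [:: (a : nat -> A); b : nat -> A] jn.1 jn.2.
exists (ieval h : {rmorphism Pol -> A}).
exists (Witt pr (wvar 0)), (Witt pr (wvar 1)), (Witt pr (wvar 2)).
by split; apply: witt_ext => n; apply: esym; apply: ieval_ivar.
Qed.

Let reg := @natrX_ipoly_inj p pr.

Lemma witt_addA : associative (@witt_add A).
Proof.
move=> a b c; have [f [u [v [w [-> -> ->]]]]] := witt_lift3 a b c.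
rewrite -(witt_map_add f v w) -(witt_map_add f u v).
rewrite -(witt_map_add f u (witt_add v w)) -(witt_map_add f (witt_add u v) w).
exact: (congr1 (witt_map f) (witt_reg_addA reg u v w)).
Qed.

Lemma witt_addC : commutative (@witt_add A).
Proof.
move=> a b; have [f [u [v [_ [-> -> _]]]]] := witt_lift3 a b a.
rewrite -(witt_map_add f u v) -(witt_map_add f v u).
exact: (congr1 (witt_map f) (witt_reg_addC reg u v)).
Qed.

Lemma witt_add0 : left_id (witt_zero A) (@witt_add A).
Proof.
move=> a; have [f [u [_ [_ [-> _ _]]]]] := witt_lift3 a a a.
rewrite -(witt_map_zero f) -(witt_map_add f (witt_zero _) u).
exact: (congr1 (witt_map f) (witt_reg_add0 reg u)).
Qed.

Lemma witt_addN : left_inverse (witt_zero A) (@witt_opp A) (@witt_add A).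
Proof.
move=> a; have [f [u [_ [_ [-> _ _]]]]] := witt_lift3 a a a.
rewrite -(witt_map_opp f u) -(witt_map_add f (witt_opp u) u) -(witt_map_zero f).
exact: (congr1 (witt_map f) (witt_reg_addN reg u)).
Qed.

Lemma witt_mulA : associative (@witt_mul A).
Proof.
move=> a b c; have [f [u [v [w [-> -> ->]]]]] := witt_lift3 a b c.
rewrite -(witt_map_mul f v w) -(witt_map_mul f u v).
rewrite -(witt_map_mul f u (witt_mul v w)) -(witt_map_mul f (witt_mul u v) w).
exact: (congr1 (witt_map f) (witt_reg_mulA reg u v w)).
Qed.

Lemma witt_mulC : commutative (@witt_mul A).
Proof.
move=> a b; have [f [u [v [_ [-> -> _]]]]] := witt_lift3 a b a.
rewrite -(witt_map_mul f u v) -(witt_map_mul f v u).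
exact: (congr1 (witt_map f) (witt_reg_mulC reg u v)).
Qed.

Lemma witt_mul1 : left_id (witt_one A) (@witt_mul A).
Proof.
move=> a; have [f [u [_ [_ [-> _ _]]]]] := witt_lift3 a a a.
rewrite -(witt_map_one f) -(witt_map_mul f (witt_one _) u).
exact: (congr1 (witt_map f) (witt_reg_mul1 reg u)).
Qed.

Lemma witt_mulDl : left_distributive (@witt_mul A) (@witt_add A).
Proof.
move=> a b c; have [f [u [v [w [-> -> ->]]]]] := witt_lift3 a b c.
rewrite -(witt_map_add f u v) -(witt_map_mul f u w) -(witt_map_mul f v w).
rewrite -(witt_map_mul f (witt_add u v) w).
rewrite -(witt_map_add f (witt_mul u w) (witt_mul v w)).
exact: (congr1 (witt_map f) (witt_reg_mulDl reg u v w)).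
Qed.

HB.instance Definition _ := GRing.isZmodule.Build W
  witt_addA witt_addC witt_add0 witt_addN.
HB.instance Definition _ := GRing.Zmodule_isComPzRing.Build W
  witt_mulA witt_mulC witt_mul1 witt_mulDl.

End RingLaws.
End WittRing.

Section PerfectoidRing.
Variables (p : nat) (pr : prime p) (S : comPzRingType).

Definition tilt :=
  @inverse_limit (fun=> mod_p p S) (fun=> frobenius_mod_p pr (S := S)).

HB.instance Definition _ := GRing.ComPzRing.on tilt.

(* The zeroth Witt coordinate is the reduction modulo p, the zeroth component
   of an element of the tilt its first projection. *)
Definition is_fontaine_map (theta : witt pr tilt -> S) :=
  forall w : witt pr tilt,
    quot_proj (principal_ideal (p%:R : S)) (theta w) = w 0%N 0%N.

(* Fontaine's map enters as the unique ring map lifting the reduction; the first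
   condition makes S p-adically complete, so that such a map exists and is
   unique. *)
Definition perfectoid_ring :=
  [/\ exists2 w : S, exists a, p%:R = a * w ^+ p &
        adically_complete_separated (principal_ideal w),
      forall x : mod_p p S, exists y, frobenius_mod_p pr y = x &
      exists theta : {rmorphism witt pr tilt -> S},
      [/\ is_fontaine_map theta,
          forall theta' : {rmorphism witt pr tilt -> S},
            is_fontaine_map theta' -> theta' =1 theta &
          exists a, [set w | theta w = 0] = principal_ideal a]].

End PerfectoidRing.

Section TowerMap.
Variables (R : nat -> comPzRingType) (t : forall i, {rmorphism R i -> R i.+1}).

Fixpoint tower_map i : R 0%N -> R i :=
  if i is i'.+1 then t i' \o tower_map i' else idfun.

Lemma tower_map_is_zmod i : zmod_morphism (tower_map i).
Proof. by move=> x y; elim: i => //= i ->; rewrite raddfB. Qed.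

Lemma tower_map_is_monoid i : monoid_morphism (tower_map i).
Proof.
split=> [|x y]; first by elim: i => //= i ->; rewrite rmorph1.
by elim: i => //= i ->; rewrite rmorphM.
Qed.

HB.instance Definition _ i := GRing.isZmodMorphism.Build (R 0%N) (R i)
  (tower_map i) (tower_map_is_zmod i).
HB.instance Definition _ i := GRing.isMonoidMorphism.Build (R 0%N) (R i)
  (tower_map i) (tower_map_is_monoid i).

End TowerMap.

Section PerfectoidTower.
Variables (p : nat) (R : nat -> comPzRingType).
Variables (t : forall i, {rmorphism R i -> R i.+1}) (I0 : ideal (R 0%N)).

(* [base_ideal i] is the ideal generated by I0 in R i. *)
Definition base_ideal i : ideal (R i) := ideal_extension (tower_map t i) I0.

Lemma base_ideal_step i x : base_ideal i x -> base_ideal i.+1 (t i x).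
Proof.
apply: ideal_extension_preim => y I0y.
by apply: sub_ideal_gen; exists y.
Qed.

Definition tower_quot i := quotient (base_ideal i).

HB.instance Definition _ i := GRing.ComPzRing.on (tower_quot i).

Definition tower_quot_map i : tower_quot i -> tower_quot i.+1 :=
  quot_map (@base_ideal_step i).

HB.instance Definition _ i := GRing.RMorphism.on (tower_quot_map (i := i)).

Definition purely_inseparable :=
  [/\ I0 p%:R,
      forall i, injective (@tower_quot_map i) &
      forall i (x : tower_quot i.+1), exists y, @tower_quot_map i y = x ^+ p].

(* The value is 0 where it does not exist; for a purely inseparable tower this
   is the unique ring map whose composite with [tower_quot_map i] is the
   Frobenius endomorphism, see the lemmas below. *)
Definition frob_proj i (x : tower_quot i.+1) : tower_quot i :=
  xget 0 [set y | tower_quot_map y = x ^+ p].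

Lemma frob_projE i (x : tower_quot i.+1) : purely_inseparable ->
  tower_quot_map (frob_proj x) = x ^+ p.
Proof. by case=> _ _ /(_ i x); exact: xgetPex. Qed.

Lemma frob_proj_unique i (f : tower_quot i.+1 -> tower_quot i) :
  purely_inseparable -> (forall x, tower_quot_map (f x) = x ^+ p) ->
  f =1 @frob_proj i.
Proof.
move=> pi fE x; case: (pi) => _ inj _.
by apply: inj; rewrite fE frob_projE.
Qed.

Lemma tower_quot_char i : purely_inseparable -> p%:R = 0 :> tower_quot i.
Proof.
case=> pI _ _; rewrite -(rmorph_nat (quot_proj (base_ideal i))).
rewrite -(rmorph0 (quot_proj (base_ideal i))); apply/quot_projP.
rewrite subr0 -(rmorph_nat (tower_map t i)).
by apply: sub_ideal_gen; exists p%:R.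
Qed.

Lemma frob_proj_is_zmod i : prime p -> purely_inseparable ->
  zmod_morphism (@frob_proj i).
Proof.
move=> pr pi x y; case: (pi) => _ inj _; apply: inj.
apply: etrans (frob_projE _ pi) _.
apply: etrans (expr_prime_char_sub pr (tower_quot_char i.+1 pi) x y) _.
apply/esym/(etrans (raddfB _ _ _)).
by congr (_ - _); exact: frob_projE.
Qed.

Lemma frob_proj_is_monoid i : purely_inseparable ->
  monoid_morphism (@frob_proj i).
Proof.
move=> pi; case: (pi) => _ inj _; split=> [|x y]; apply: inj.
  by rewrite rmorph1 frob_projE// expr1n.
by rewrite rmorphM /= !frob_projE// exprMn.
Qed.

Definition torsion i : set (R i) :=
  [set m | forall x, I0 x ->
     exists n, (0 < n)%N /\ tower_map t i x ^+ n * m = 0].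

(* [tower_map (fun j => t j.+1) i] is the map from R 1 to R i.+1. *)
Definition first_pillar (I1 : ideal (R 1%N)) :=
  [/\ is_principal I1,
      ideal_pow I1 p = base_ideal 1%N &
      forall i, [set x | frob_proj x = 0] =
        ideal_extension (quot_proj (base_ideal i.+1) \o
                         tower_map (R := fun j => R j.+1) (fun j => t j.+1) i)
          I1].

Definition perfectoid_tower :=
  [/\ purely_inseparable,
      forall i (y : tower_quot i), exists x, frob_proj x = y,
      forall i, base_ideal i `<=` @jacobson_radical (R i),
      is_principal I0 /\ (exists I1, first_pillar I1) &
      forall i,
        (forall a m, I0 a -> @torsion i m -> tower_map t i a * m = 0) /\
        exists g : R i.+1 -> R i,
          set_bij (@torsion i.+1) (@torsion i) g /\
          forall m, @torsion i.+1 m ->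
            quot_proj (base_ideal i) (g m) =
            frob_proj (quot_proj (base_ideal i.+1) m)].

End PerfectoidTower.

(* Main.v *)
(* Let A be the colimit of the tower and w the image of a generator of I_1, so
   that w^p generates I_0 A.  The tower axioms say that Frobenius induces an
   isomorphism A/w -> A/w^p and that the p-th power map is bijective on the
   w-power torsion; the latter is killed by w since w times it consists of
   nilpotent torsion elements.  These properties pass to the w-adic completion
   S of A and imply that S is perfectoid, as follows.

   Frobenius is onto on S/p, so that every element of the tilt T has a
   compatible system of p-power roots in S, and some pi in T is sent by the
   sharp map to a unit multiple of w.  As p is a multiple of w^p, there is
   xi = p - [pi] alpha in the kernel of theta.  If theta x = 0, then the zeroth
   coordinate of x lies in pi T, because Frobenius A/w -> A/w^p is injective;
   hence x = xi b + [pi] c and w theta(c) = 0.  The torsion element theta(c) has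
   a system of p-power roots in the torsion, that is, theta(c) = theta([m]) with
   m in T, and pi m = 0 since torsion is reduced.  Replacing c by c - [m], one
   gets ker theta = (xi) + [pi] ker theta, and ker theta = (xi) follows by
   completeness. *)
Require Import Defs.
From mathcomp Require Import all_boot all_algebra.
Import GRing.Theory.
From HB Require Import structures.
From mathcomp Require Import boolp classical_sets functions ring.
From mathcomp.multinomials Require Import monalg.

Set Implicit Arguments.
Unset Strict Implicit.
Unset Printing Implicit Defensive.
Local Open Scope ring_scope.

(** * Divisibility and compatible systems of p-power roots *)

(* Membership in a principal ideal; unlike the latter it does not unfold to a
   product, which would disturb implicit arguments. *)
Definition dvr (A : comPzRingType) (e x : A) : Prop := exists r, x = r * e.

Local Notation "e %|| x" := (dvr e x) (at level 70).

Section PrincipalDivisibility.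
Variable A : comPzRingType.
Implicit Types d e x y : A.

Lemma dvrP e x : principal_ideal e x <-> e %|| x.
Proof. exact: principal_idealP. Qed.

Lemma dvr0 e : e %|| 0.
Proof. by exists 0; rewrite mul0r. Qed.

Lemma dvrM e a x : e %|| x -> e %|| a * x.
Proof. by move=> [r ->]; exists (a * r); rewrite mulrA. Qed.

Lemma dvrD e x y : e %|| x -> e %|| y -> e %|| x + y.
Proof. by move=> [r ->] [s ->]; exists (r + s); rewrite mulrDl. Qed.

Lemma dvrN e x : e %|| x -> e %|| - x.
Proof. by move=> [r ->]; exists (- r); rewrite mulNr. Qed.

Lemma dvrB e x y : e %|| x -> e %|| y -> e %|| x - y.
Proof. by move=> hx hy; apply: dvrD => //; exact: dvrN. Qed.

Lemma dvr_mulr e x : e %|| x * e.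
Proof. by exists x. Qed.

Lemma dvr_mull e x : e %|| e * x.
Proof. by rewrite mulrC; exact: dvr_mulr. Qed.

Lemma dvr_refl e : e %|| e.
Proof. by rewrite -[X in _ %|| X]mul1r; exact: dvr_mulr. Qed.

Lemma dvr_trans d e x : d %|| e -> e %|| x -> d %|| x.
Proof.
by move=> de [r ->]; exact: dvrM.
Qed.

Lemma dvr_sym e x y : e %|| x - y -> e %|| y - x.
Proof. by move=> h; rewrite -opprB; exact: dvrN. Qed.

Lemma dvr_subr_trans e x y z : e %|| x - y -> e %|| y - z -> e %|| x - z.
Proof. by move=> h1 h2; rewrite -(subrKA y); exact: dvrD. Qed.

Lemma dvr_mul d e x y : d %|| x -> e %|| y -> d * e %|| x * y.
Proof.
by move=> [r ->] [s ->]; rewrite mulrACA; exact: dvr_mulr.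
Qed.

Lemma dvr_expn d e n : d %|| e -> d ^+ n %|| e ^+ n.
Proof.
by move=> de; elim: n => [|n IH]; [exact: dvr_refl|rewrite !exprS; exact: dvr_mul].
Qed.

Lemma dvr_exp_leq e m n x : (m <= n)%N -> e ^+ n %|| x -> e ^+ m %|| x.
Proof.
by move=> /subnK <-; apply: dvr_trans; rewrite exprD; exact: dvr_mulr.
Qed.

Lemma dvr_subX e x y n : e %|| x - y -> e %|| x ^+ n - y ^+ n.
Proof. by move=> h; rewrite subrXX mulrC; exact: dvrM. Qed.

Lemma dvr_subM e x y x' y' :
  e %|| x - x' -> e %|| y - y' -> e %|| x * y - x' * y'.
Proof.
move=> hx hy; have -> : x * y - x' * y' = y * (x - x') + x' * (y - y') by ring.
by apply: dvrD; apply: dvrM.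
Qed.

Lemma dvr_quot e x y :
  quot_proj (principal_ideal e) x = quot_proj (principal_ideal e) y <->
  e %|| x - y.
Proof. by rewrite quot_projP; exact: dvrP. Qed.

Definition adic_complete e :=
  (forall x, (forall n, e ^+ n %|| x) -> x = 0) /\
  forall u : nat -> A, (forall n, e ^+ n %|| u n.+1 - u n) ->
    exists s, forall n, e ^+ n %|| s - u n.

Lemma adic_eq e x y : adic_complete e -> (forall n, e ^+ n %|| x - y) -> x = y.
Proof. by move=> [sep _] h; apply/subr0_eq/sep. Qed.

(** The increments of [u] are multiples of powers of [e], so the tail after [n] is [e ^+ n] times a
    series that converges [d]-adically; its sum [t n] shows that the limit is even [e]-adic. *)
Lemma adic_complete_dvr d e : adic_complete d -> d %|| e -> adic_complete e.
Proof.
move=> cd de; split=> [x h|u hu].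
  by apply: cd.1 => n; apply: dvr_trans (h n); exact: dvr_expn.
have /choice[c hc] n : exists c, u n.+1 - u n = c * e ^+ n.
  exact: hu.
have part n m : u (n + m)%N = u n + e ^+ n * \sum_(j < m) c (n + j)%N * e ^+ j.
  elim: m => [|m IH]; first by rewrite addn0 big_ord0 mulr0 addr0.
  rewrite big_ord_recr /= addnS -(subrK (u (n + m)%N) (u (n + m).+1)) hc IH exprD.
  by ring.
have /choice[t ht] n : exists t, forall m,
    d ^+ m %|| t - \sum_(j < m) c (n + j)%N * e ^+ j.
  apply: cd.2 => m; rewrite big_ord_recr /= addrAC subrr add0r.
  by apply: dvrM; exact: dvr_expn.
exists (u 0%N + t 0%N) => n; suff -> : u 0%N + t 0%N = u n + e ^+ n * t n.
  by rewrite addrAC subrr add0r; exact: dvr_mull.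
apply: adic_eq cd _ => m.
apply: (@dvr_subr_trans _ _ (u (n + m)%N)).
  apply: (@dvr_exp_leq _ _ (n + m)); first exact: leq_addl.
  have -> : u (n + m)%N = u 0%N + \sum_(j < n + m) c j * e ^+ j.
    by have := part 0%N (n + m)%N; rewrite add0n mul1r.
  by rewrite opprD addrACA subrr add0r; exact: (ht 0%N).
rewrite part opprD addrACA subrr add0r -mulrBr.
by apply: dvrM; apply: dvr_sym; exact: ht.
Qed.

Lemma unit_1addM e x : adic_complete e -> exists y, (1 + e * x) * y = 1.
Proof.
move=> ce; pose u n := \sum_(i < n) (- (e * x)) ^+ i.
have [s hs] : exists s, forall n, e ^+ n %|| s - u n.
  apply: ce.2 => n; rewrite /u big_ord_recr /= addrAC subrr add0r.
  by rewrite -mulrN exprMn; exact: dvr_mull.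
exists s; apply: adic_eq ce _ => n.
apply: (@dvr_subr_trans _ _ ((1 + e * x) * u n)).
  by rewrite -mulrBr; exact: dvrM.
have -> : (1 + e * x) * u n = 1 - (- (e * x)) ^+ n.
  by rewrite -[RHS]opprB subrX1 -mulNr opprB opprK.
by rewrite addrAC subrr add0r -mulrN exprMn -mulrN; exact: dvr_mull.
Qed.

End PrincipalDivisibility.

Section PowerCompatible.
Variables (p : nat) (A : comPzRingType).
Implicit Types (e : A) (x y : nat -> A).

(** The cofactor of [a - b] in [a ^+ p - b ^+ p] is congruent to [p * b ^+ p.-1] modulo [e], hence a
    multiple of [e]. *)
Lemma dvr_lift e (a b : A) n : e %|| p%:R ->
  e ^+ n.+1 %|| a - b -> e ^+ n.+2 %|| a ^+ p - b ^+ p.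
Proof.
move=> ep h; rewrite subrXX [e ^+ n.+2]exprSr; apply: dvr_mul => //.
have hab : quot_proj (principal_ideal e) a = quot_proj (principal_ideal e) b.
  by apply/dvr_quot; rewrite -[e]expr1; exact: dvr_exp_leq h.
rewrite -[X in _ %|| X]subr0; apply/dvr_quot; rewrite rmorph0 rmorph_sum.
rewrite (eq_bigr (fun=> quot_proj (principal_ideal e) (b ^+ p.-1))); last first.
  move=> i _; rewrite rmorphM !rmorphXn /= hab -exprD subnK //=.
  by rewrite -ltnS (leq_trans (ltn_ord i)) // leqSpred.
rewrite sumr_const card_ord -raddfMn -(rmorph0 (quot_proj (principal_ideal e))).
by apply/dvr_quot; rewrite subr0 -mulr_natr; exact: dvrM.
Qed.

Lemma dvr_lift_iter e (a b : A) n : e %|| p%:R -> e %|| a - b ->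
  e ^+ n.+1 %|| a ^+ (p ^ n) - b ^+ (p ^ n).
Proof.
move=> ep h; elim: n => [|n IH]; first by rewrite expn0 !expr1.
by rewrite expnSr !exprM; exact: dvr_lift.
Qed.

Definition power_compatible x := forall n, x n.+1 ^+ p = x n.

Lemma power_compatibleX x n k : power_compatible x ->
  x (n + k)%N ^+ (p ^ k) = x n.
Proof.
move=> hx; elim: k => [|k IH]; first by rewrite addn0 expn0 expr1.
by rewrite addnS expnS exprM hx.
Qed.

(** A congruence modulo [e] at level [n + k] becomes one modulo [e ^+ k.+1] at level [n] after
    taking [p ^ k]-th powers. *)
Lemma power_compatible_eq e x y : e %|| p%:R -> adic_complete e ->
  power_compatible x -> power_compatible y ->
  (forall n, e %|| x n - y n) -> forall n, x n = y n.
Proof.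
move=> ep ce hx hy h n; apply: adic_eq ce _ => k.
apply: (@dvr_exp_leq _ _ _ k.+1) => //.
rewrite -(power_compatibleX n k hx) -(power_compatibleX n k hy).
exact: dvr_lift_iter.
Qed.

(** [x n] is the limit over [k] of the [p ^ k]-th powers of [y (n + k)]. *)
Lemma power_compatible_lift e y : e %|| p%:R -> adic_complete e ->
  (forall n, e %|| y n.+1 ^+ p - y n) ->
  exists2 x, power_compatible x & forall n, e %|| x n - y n.
Proof.
move=> ep ce hy.
have step n k :
    e ^+ k.+1 %|| y (n + k.+1)%N ^+ (p ^ k.+1) - y (n + k)%N ^+ (p ^ k).
  by rewrite addnS expnS exprM; exact: dvr_lift_iter.
have /choice[x hx] n : exists s, forall k, e ^+ k %|| s - y (n + k)%N ^+ (p ^ k).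
  by apply: ce.2 => k; apply: dvr_exp_leq (step n k).
exists x => n.
  apply: adic_eq ce _ => k.
  apply: (@dvr_subr_trans _ _ _ (y (n + k.+1)%N ^+ (p ^ k.+1))).
    rewrite expnSr exprM addnS -addSn; apply: dvr_subX; exact: hx.
  by apply: dvr_sym; apply: (@dvr_exp_leq _ _ _ k.+1).
apply: (@dvr_subr_trans _ _ _ (y (n + 1)%N ^+ (p ^ 1))).
  by have := hx n 1%N; rewrite expr1.
by have := step n 0%N; rewrite expr1 addn0 expn0 expr1.
Qed.

End PowerCompatible.

(** * Witt vectors *)

Section WittVectors.
Variables (p : nat) (pr : prime p).

Lemma witt_map_is_zmod (A B : comPzRingType) (f : {rmorphism A -> B}) :
  zmod_morphism (witt_map f : witt pr A -> witt pr B).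
Proof.
move=> x y; apply: etrans (witt_map_add f x (witt_opp y)) _.
exact: (congr1 (witt_add (witt_map f x)) (witt_map_opp f y)).
Qed.

Lemma witt_map_is_monoid (A B : comPzRingType) (f : {rmorphism A -> B}) :
  monoid_morphism (witt_map f : witt pr A -> witt pr B).
Proof. by split=> [|x y]; [exact: witt_map_one|exact: witt_map_mul]. Qed.

HB.instance Definition _ (A B : comPzRingType) (f : {rmorphism A -> B}) :=
  GRing.isZmodMorphism.Build (witt pr A) (witt pr B) (witt_map f)
    (witt_map_is_zmod f).
HB.instance Definition _ (A B : comPzRingType) (f : {rmorphism A -> B}) :=
  GRing.isMonoidMorphism.Build (witt pr A) (witt pr B) (witt_map f)
    (witt_map_is_monoid f).

Definition witt_ghost (A : comPzRingType) n (x : witt pr A) : A := ghost p x n.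

Lemma witt_ghost_is_zmod (A : comPzRingType) n : zmod_morphism (@witt_ghost A n).
Proof.
move=> x y; apply: etrans (ghost_add x (witt_opp y) n) _.
exact: (congr1 (+%R (ghost p x n)) (ghost_opp y n)).
Qed.

Lemma witt_ghost_is_monoid (A : comPzRingType) n :
  monoid_morphism (@witt_ghost A n).
Proof. by split=> [|x y]; [exact: ghost_one|exact: ghost_mul]. Qed.

HB.instance Definition _ (A : comPzRingType) n :=
  GRing.isZmodMorphism.Build (witt pr A) A (@witt_ghost A n)
    (@witt_ghost_is_zmod A n).
HB.instance Definition _ (A : comPzRingType) n :=
  GRing.isMonoidMorphism.Build (witt pr A) A (@witt_ghost A n)
    (@witt_ghost_is_monoid A n).

Lemma witt_ghost0 (A : comPzRingType) (x : witt pr A) : witt_ghost 0 x = x 0%N.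
Proof. by rewrite /witt_ghost ghost_rec big_ord0 add0r mul1r. Qed.

(** In the [k]-th term, [p ^ k] gives [k] factors [e] and the [p ^ (n - k)]-th power the remaining
    [n - k + 1]. *)
Lemma ghost_congr (A : comPzRingType) (e : A) (a b : nat -> A) n :
  e %|| p%:R -> (forall k, e %|| a k - b k) ->
  e ^+ n.+1 %|| ghost p a n - ghost p b n.
Proof.
move=> ep h; rewrite /ghost -sumrB; elim/big_ind: _ => [||k _].
- exact: dvr0.
- by move=> *; exact: dvrD.
- have kn : (k <= n)%N by rewrite -ltnS.
  rewrite -mulrBr -{1}(subnKC kn) -addnS exprD; apply: dvr_mul.
    exact: dvr_expn.
  exact: dvr_lift_iter.
Qed.

(** By induction the terms below [n] agree modulo [p ^ n.+1], which leaves [p ^ n * (a n - b n)];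
    then [p ^ n] is cancelled. *)
Lemma ghost_congr_inv (A : comPzRingType) (a b : nat -> A) :
  (forall n (x y : A), p%:R ^+ n * x = p%:R ^+ n * y -> x = y) ->
  (forall n, p%:R ^+ n.+1 %|| ghost p a n - ghost p b n) ->
  forall n, p%:R %|| a n - b n.
Proof.
move=> reg h n; elim/ltn_ind: n => n IH.
have := h n; rewrite !ghost_rec opprD addrACA -sumrB -mulrBr => hn.
have hs : p%:R ^+ n.+1 %|| \sum_(i < n)
    (p%:R ^+ i * a i ^+ (p ^ (n - i)) - p%:R ^+ i * b i ^+ (p ^ (n - i))).
  elim/big_ind: _ => [||k _]; [exact: dvr0|by move=> *; exact: dvrD|].
  rewrite -mulrBr -{1}(subnKC (ltnW (ltn_ord k))) -addnS exprD; apply: dvr_mul.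
    exact: dvr_refl.
  by apply: dvr_lift_iter => //; [exact: dvr_refl|exact: IH].
have [r e] := dvrB hn hs.
exists r; apply: reg.
move: e; rewrite addrAC subrr add0r => e; apply: etrans e _; rewrite exprS; ring.
Qed.

Definition teichmuller (A : comPzRingType) (x : A) : witt pr A :=
  Witt pr (fun n => if n is 0%N then x else 0).

Lemma ghost_teichmuller (A : comPzRingType) (x : A) n :
  ghost p (teichmuller x) n = x ^+ (p ^ n).
Proof.
rewrite /ghost big_ord_recl expr0 mul1r subn0 big1 ?addr0 // => k _.
by rewrite /= expr0n expn_eq0 eqn0Ngt prime_gt0 //= mulr0.
Qed.

Lemma witt_map_teichmuller (A B : comPzRingType) (f : {rmorphism A -> B})
    (x : A) :
  witt_map f (teichmuller x) = teichmuller (f x).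
Proof. by apply: witt_ext => -[|n] //=; rewrite rmorph0. Qed.

(** Over [B] the ghost map is injective, so identities of Witt vectors can be checked on ghost
    components there and pushed forward to [A]. *)
Lemma witt_lift_regular (A : comPzRingType) (a b : witt pr A) :
  exists (B : comPzRingType) (f : {rmorphism B -> A}) (u v : witt pr B),
  [/\ forall n (x y : B), p%:R ^+ n * x = p%:R ^+ n * y -> x = y,
      a = witt_map f u & b = witt_map f v].
Proof.
have [f [u [v [_ [-> -> _]]]]] := witt_lift3 a b a.
exists (ipoly (nat * nat)%type), f, u, v.
by split; [exact: (@natrX_ipoly_inj p pr)|reflexivity|reflexivity].
Qed.

Lemma teichmullerM (A : comPzRingType) :
  {morph @teichmuller A : x y / x * y}.
Proof.
move=> x y; have [B [f [u [v [reg eu ev]]]]] :=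
  witt_lift_regular (teichmuller x) (teichmuller y).
have -> : x = f (u 0%N) by have := congr1 (fun w : witt pr A => w 0%N) eu.
have -> : y = f (v 0%N) by have := congr1 (fun w : witt pr A => w 0%N) ev.
rewrite -rmorphM -!(witt_map_teichmuller f) -[RHS]rmorphM; congr (witt_map f _).
apply: (witt_ghost_ext reg) => n.
rewrite ghost_teichmuller exprMn -!ghost_teichmuller.
by apply: esym; exact: ghost_mul.
Qed.

Lemma teichmuller1 (A : comPzRingType) : teichmuller (1 : A) = 1.
Proof. by apply: witt_ext => -[|n]. Qed.

Lemma teichmullerX (A : comPzRingType) (x : A) n :
  teichmuller (x ^+ n) = teichmuller x ^+ n.
Proof.
by elim: n => [|n IH]; rewrite ?expr0 ?teichmuller1// !exprS teichmullerM IH.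
Qed.

Lemma teichmuller0 (A : comPzRingType) : teichmuller (0 : A) = 0.
Proof. by apply: witt_ext => -[|n]. Qed.

(* Multiplication by p is Verschiebung composed with Frobenius. *)
Lemma witt_mul_natr_char (A : comPzRingType) (x : witt pr A) :
  p%:R = 0 :> A ->
  p%:R * x = Witt pr (fun n => if n is n'.+1 then x n' ^+ p else 0).
Proof.
move=> pA; have [B [f [u [_ [reg -> _]]]]] := witt_lift_regular x x.
rewrite -(rmorph_nat (witt_map f)) -rmorphM; apply: witt_ext => n.
pose v := fun n => if n is n'.+1 then u n' ^+ p else 0.
(* Over [B] the formula holds only modulo [p], as the ghost components differ by [p ^ n.+1 * u n];
   the map to [A] kills [p]. *)
have /(_ n)[r e] : forall n, p%:R %|| (p%:R * u : witt pr _) n - v n.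
  apply: (ghost_congr_inv reg) => {}n.
  rewrite -[ghost p (p%:R * u) n]/(witt_ghost n (p%:R * u)) rmorphM rmorph_nat.
  rewrite /= /witt_ghost ghost_rec /ghost big_ord_recl /= expr0 mul1r expr0n.
  rewrite expn_eq0 eqn0Ngt prime_gt0 // add0r mulrDr mulr_sumr.
  rewrite [X in _ + _ - X](eq_bigr (fun k : 'I_n =>
    p%:R * (p%:R ^+ k * u k ^+ (p ^ (n - k))))).
    by rewrite addrAC subrr add0r mulrA -exprS; exact: dvr_mull.
  by move=> k _; rewrite mulrA -exprS -exprM -expnS -subSn.
rewrite /= -[X in f X](subrK (v n)) e rmorphD rmorphM rmorph_nat pA mulr0 add0r.
by case: n {e} => [|n] /=; rewrite ?rmorph0 ?rmorphXn.
Qed.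

Lemma witt_dvr_natr (A : comPzRingType) (x : witt pr A) :
  p%:R = 0 :> A -> (forall a : A, exists b, b ^+ p = a) ->
  x 0%N = 0 -> p%:R %|| x.
Proof.
move=> pA perf x0; have /choice[b hb] n : exists b, b ^+ p = x n.+1.
  exact: perf.
suff -> : x = p%:R * Witt pr b by exact: dvr_mull.
by rewrite witt_mul_natr_char //; apply: witt_ext => -[|n] /=.
Qed.

Lemma witt_sub_teichmuller (A : comPzRingType) (x : witt pr A) :
  p%:R = 0 :> A -> (forall a : A, exists b, b ^+ p = a) ->
  p%:R %|| x - teichmuller (x 0%N).
Proof.
move=> pA perf; apply: witt_dvr_natr => //.
by rewrite -witt_ghost0 raddfB /= !witt_ghost0 subrr.
Qed.

End WittVectors.

(** * A criterion for perfectoid rings *)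

Section PerfectoidCriterion.
Variables (p : nat) (pr : prime p) (S : comPzRingType) (w : S).
Hypothesis w_complete : adic_complete w.
Hypothesis w_dvr_p : w ^+ p %|| p%:R.
Hypothesis frob_surj : forall x : S, exists y, p%:R %|| x - y ^+ p.

Local Notation T := (tilt pr S).
Local Notation modp := (quot_proj (principal_ideal (p%:R : S))).
Local Notation modw := (quot_proj (principal_ideal w)).

Let w_dvr : w %|| p%:R.
Proof.
apply: dvr_trans w_dvr_p; rewrite -{1}[w]expr1.
by apply: (@dvr_exp_leq _ _ _ p); [exact: prime_gt0|exact: dvr_refl].
Qed.

Let p_complete : adic_complete (p%:R : S).
Proof. exact: adic_complete_dvr w_complete w_dvr. Qed.

(** * The sharp map and the reductions of the tilt *)

Definition tilt_proj n (x : T) : mod_p p S := x n.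

Lemma tilt_proj_is_zmod n : zmod_morphism (tilt_proj n).
Proof. by []. Qed.
Lemma tilt_proj_is_monoid n : monoid_morphism (tilt_proj n).
Proof. by []. Qed.
HB.instance Definition _ n := GRing.isZmodMorphism.Build T (mod_p p S)
  (tilt_proj n) (tilt_proj_is_zmod n).
HB.instance Definition _ n := GRing.isMonoidMorphism.Build T (mod_p p S)
  (tilt_proj n) (tilt_proj_is_monoid n).

Lemma tilt_projX n (x : T) : tilt_proj n.+1 x ^+ p = tilt_proj n x.
Proof. exact: invlim_valP x n. Qed.

(* [sharp x n] is the image of the p^n-th root of x under the multiplicative
   map from the tilt to S. *)
Definition sharp (x : T) : nat -> S :=
  xget (fun=> 0) [set s | power_compatible p s /\
                     forall n, modp (s n) = tilt_proj n x].

Lemma sharpP (x : T) :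
  power_compatible p (sharp x) /\ forall n, modp (sharp x n) = tilt_proj n x.
Proof.
have [n|s sc sx] := @power_compatible_lift p S p%:R
    (fun n => quot_repr (tilt_proj n x)) (dvr_refl _) p_complete.
  apply/dvr_quot; rewrite rmorphXn /= !quot_reprK; exact: tilt_projX.
rewrite /sharp; case: xgetP => [t -> //|/(_ s)[]]; split=> // n.
by have /dvr_quot := sx n; rewrite quot_reprK.
Qed.

Lemma sharp_power_compatible x : power_compatible p (sharp x).
Proof. by case: (sharpP x). Qed.

Lemma sharpE x n : modp (sharp x n) = tilt_proj n x.
Proof. by case: (sharpP x). Qed.

Lemma sharp_eq x s : power_compatible p s ->
  (forall n, modp (s n) = tilt_proj n x) -> forall n, sharp x n = s n.
Proof.
move=> sc sx; apply: (power_compatible_eq (dvr_refl _) p_complete) => //.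
  exact: sharp_power_compatible.
by move=> n; apply/dvr_quot; rewrite sharpE sx.
Qed.

Lemma sharpM x y n : sharp (x * y) n = sharp x n * sharp y n.
Proof.
apply: (sharp_eq (s := fun n => sharp x n * sharp y n)) => {}n.
  by rewrite exprMn !sharp_power_compatible.
by rewrite !rmorphM /= !sharpE.
Qed.

Lemma sharp1 n : sharp 1 n = 1.
Proof.
apply: (sharp_eq (s := fun=> 1)) => {}n; first exact: expr1n.
by rewrite !rmorph1.
Qed.

Lemma sharp0 n : sharp 0 n = 0.
Proof.
apply: (sharp_eq (s := fun=> 0)) => {}n; last by rewrite !rmorph0.
by rewrite expr0n eqn0Ngt prime_gt0.
Qed.

Lemma sharpX x n m : sharp (x ^+ m) n = sharp x n ^+ m.
Proof. by elim: m => [|m IH]; rewrite ?sharp1 // !exprS sharpM IH. Qed.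

Lemma sharpB x y n : p%:R %|| sharp (x - y) n - (sharp x n - sharp y n).
Proof. by apply/dvr_quot; rewrite !rmorphB /= !sharpE raddfB. Qed.

Lemma sharp_surj s : power_compatible p s -> exists x, forall n, sharp x n = s n.
Proof.
move=> sc.
have sP n : frobenius_mod_p pr (modp (s n.+1)) = modp (s n).
  by rewrite /frobenius_mod_p -rmorphXn sc.
by exists (InverseLimit sP); apply: sharp_eq.
Qed.

(** The [n]-th kernel of these reductions contains the [p ^ n]-th power of every [x] with [w]
    dividing [sharp x 0]; convergence in the tilt is measured by these kernels. *)
Definition tilt_red n (x : T) : quotient (principal_ideal w) := modw (sharp x n).

Lemma tilt_red_is_zmod n : zmod_morphism (tilt_red n).
Proof.
move=> x y; rewrite /tilt_red -raddfB; apply/dvr_quot.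
by apply: dvr_trans w_dvr _; exact: sharpB.
Qed.
Lemma tilt_red_is_monoid n : monoid_morphism (tilt_red n).
Proof.
by split=> [|x y]; rewrite /tilt_red ?sharp1 ?rmorph1 // sharpM rmorphM.
Qed.
HB.instance Definition _ n := GRing.isZmodMorphism.Build T
  (quotient (principal_ideal w)) (tilt_red n) (tilt_red_is_zmod n).
HB.instance Definition _ n := GRing.isMonoidMorphism.Build T
  (quotient (principal_ideal w)) (tilt_red n) (tilt_red_is_monoid n).

Lemma tilt_red_eq0 n x : tilt_red n x = 0 <-> w %|| sharp x n.
Proof.
by rewrite -{1}(rmorph0 modw) /tilt_red; split=> [/dvr_quot|h];
  [|apply/dvr_quot]; rewrite subr0.
Qed.

Lemma tilt_redX n x : tilt_red n.+1 x ^+ p = tilt_red n x.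
Proof. by rewrite /tilt_red -rmorphXn sharp_power_compatible. Qed.

Lemma tilt_redXn n x : tilt_red n x ^+ (p ^ n) = tilt_red 0 x.
Proof.
elim: n => [|n IH]; first by rewrite expr1.
by rewrite expnS exprM tilt_redX.
Qed.

Lemma tilt_red_inj x y : (forall n, tilt_red n x = tilt_red n y) -> x = y.
Proof.
move=> h; apply: invlim_ext => n.
rewrite -[x n]/(tilt_proj n x) -[y n]/(tilt_proj n y) -!sharpE; congr (modp _).
apply: (power_compatible_eq w_dvr w_complete); try exact: sharp_power_compatible.
by move=> m; apply/dvr_quot; exact: h.
Qed.

(** The diagonal system [sharp (u n) n] is compatible modulo [w], because [sharp (u n.+1) n.+1 ^+ p]
    is [sharp (u n.+1) n]; so it lifts to an element of the tilt. *)
Lemma tilt_limit (u : nat -> T) :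
  (forall n, tilt_red n (u n.+1) = tilt_red n (u n)) ->
  exists s, forall n, tilt_red n s = tilt_red n (u n).
Proof.
move=> h.
have [n|x xc xu] := power_compatible_lift w_dvr w_complete
    (y := fun n => sharp (u n) n).
  by apply/dvr_quot; rewrite sharp_power_compatible; exact: h.
have [s sx] := sharp_surj xc; exists s => n.
by rewrite /tilt_red sx; apply/dvr_quot.
Qed.

Lemma tilt_root (x : T) : exists y, y ^+ p = x.
Proof.
have yc : power_compatible p (fun n => sharp x n.+1).
  by move=> n; exact: sharp_power_compatible.
have [y yx] := sharp_surj yc; exists y; apply: tilt_red_inj => n.
by rewrite /tilt_red sharpX yx sharp_power_compatible.
Qed.

Lemma tilt_rootX n (x : T) : exists y, y ^+ (p ^ n) = x.
Proof.
elim: n x => [|n IH] x; first by exists x; rewrite expr1.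
have [y <-] := tilt_root x; have [z <-] := IH y.
by exists z; rewrite expnSr exprM.
Qed.

Lemma tilt_char : p%:R = 0 :> T.
Proof.
apply: tilt_red_inj => n; rewrite rmorph_nat rmorph0 -(rmorph_nat modw).
by rewrite -(rmorph0 modw); apply/dvr_quot; rewrite subr0.
Qed.

Lemma tilt_exprD n (x y : T) : (x + y) ^+ (p ^ n) = x ^+ (p ^ n) + y ^+ (p ^ n).
Proof.
elim: n => [|n IH]; first by rewrite !expr1.
by rewrite expnSr !exprM IH expr_prime_char_add // tilt_char.
Qed.

Lemma tilt_lift (a : S) : exists x, p%:R %|| sharp x 0 - a.
Proof.
have /choice[f fP] : forall x : S, exists y, p%:R %|| x - y ^+ p.
  exact: frob_surj.
have [n|x xc xf] := power_compatible_lift (dvr_refl _) p_complete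
    (y := fun n => iter n f a).
  by apply: dvr_sym; exact: fP.
by have [y yx] := sharp_surj xc; exists y; rewrite yx; exact: (xf 0%N).
Qed.

(** * Fontaine's map *)

Lemma theta_ex (y : witt pr T) : exists s, forall n,
  p%:R ^+ n.+1 %|| s - ghost p (fun k => sharp (y k) n) n.
Proof.
pose u n := ghost p (fun k => sharp (y k) n) n.
have step n : p%:R ^+ n.+1 %|| u n.+1 - u n.
  rewrite /u ghost_rec addrAC (_ : \sum_(k < n.+1) _ = u n).
    by rewrite subrr add0r; exact: dvr_mull.
  apply: eq_bigr => k _; rewrite subSn; last by rewrite -ltnS.
  by rewrite expnS exprM sharp_power_compatible.
have [n|s sP] := p_complete.2 u; first by apply: dvr_exp_leq (step n).
by exists s => n; apply: dvr_subr_trans (sP n.+1) (step n).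
Qed.

(** This is the sum of the [p ^ k * sharp (y k) k], since the [p ^ (n - k)]-th power of
    [sharp (y k) n] is [sharp (y k) k]. Partial sums in the form of ghost components make the ring
    laws accessible. *)
Definition theta (y : witt pr T) : S := xget 0 [set s | forall n,
  p%:R ^+ n.+1 %|| s - ghost p (fun k => sharp (y k) n) n].

Lemma thetaP y n : p%:R ^+ n.+1 %|| theta y - ghost p (fun k => sharp (y k) n) n.
Proof. by move: n; exact: (xgetPex 0 (theta_ex y)). Qed.

Lemma theta_eq (y : witt pr T) s :
  (forall n, p%:R ^+ n.+1 %|| s - ghost p (fun k => sharp (y k) n) n) ->
  theta y = s.
Proof.
move=> h; apply: (adic_eq p_complete) => n; apply: (@dvr_exp_leq _ _ n n.+1) => //.
by apply: dvr_subr_trans (thetaP y n) _; exact: dvr_sym.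
Qed.

(* Modulo p^(n+1) the n-th ghost component only depends on the entries modulo
   p, so that it descends to a ring map on the Witt vectors of S/p. *)
Lemma ghost_sharp_witt (a : witt pr S) (y : witt pr T) n :
  witt_map modp a = witt_map (tilt_proj n) y ->
  p%:R ^+ n.+1 %|| ghost p (fun k => sharp (y k) n) n - ghost p a n.
Proof.
move=> e; apply: ghost_congr; first exact: dvr_refl.
move=> k; apply/dvr_quot; rewrite sharpE.
by have := congr1 (fun z : witt pr _ => z k) e => /= ->.
Qed.

(** Sums and products of coordinatewise sharp lifts need not be of that form, but they still lift
    the projection of the Witt vector; allowing any lift [a] reduces the ring laws of [theta] to
    those of ghost components. *)
Lemma theta_witt (y : witt pr T) s :
  (forall n, exists2 a : witt pr S, witt_map modp a = witt_map (tilt_proj n) y &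
     p%:R ^+ n.+1 %|| s - ghost p a n) ->
  theta y = s.
Proof.
move=> h; apply: theta_eq => n; have [a ay sa] := h n.
by apply: dvr_subr_trans sa _; apply: dvr_sym; exact: ghost_sharp_witt.
Qed.

Let sharp_witt n (y : witt pr T) : witt pr S := Witt pr (fun k => sharp (y k) n).

Let sharp_wittE n y : witt_map modp (sharp_witt n y) = witt_map (tilt_proj n) y.
Proof. by apply: witt_ext => k; exact: sharpE. Qed.

Lemma theta_is_zmod : zmod_morphism theta.
Proof.
move=> x y; apply: theta_witt => n; exists (sharp_witt n x - sharp_witt n y).
  by rewrite !rmorphB /= !sharp_wittE.
rewrite -[ghost p _ n]/(witt_ghost n _) rmorphB opprD addrACA -opprD.
by apply: dvrB; exact: thetaP.
Qed.

Lemma theta_is_monoid : monoid_morphism theta.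
Proof.
split=> [|x y]; apply: theta_witt => n.
  by exists 1; rewrite ?rmorph1 // -[ghost p _ n]/(witt_ghost n 1) rmorph1
    subrr; exact: dvr0.
exists (sharp_witt n x * sharp_witt n y).
  by rewrite !rmorphM /= !sharp_wittE.
rewrite -[ghost p _ n]/(witt_ghost n _) rmorphM.
by apply: dvr_subM; exact: thetaP.
Qed.

HB.instance Definition _ := GRing.isZmodMorphism.Build (witt pr T) S theta
  theta_is_zmod.
HB.instance Definition _ := GRing.isMonoidMorphism.Build (witt pr T) S theta
  theta_is_monoid.

Lemma theta_fontaine : is_fontaine_map theta.
Proof.
move=> y; apply: etrans (sharpE (y 0%N) 0); apply/dvr_quot.
by have := thetaP y 0; rewrite expr1 ghost_rec big_ord0 add0r mul1r.
Qed.

Lemma theta_teichmuller (x : T) : theta (teichmuller pr x) = sharp x 0.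
Proof.
apply: theta_eq => n.
rewrite (_ : (fun k => _) = teichmuller pr (sharp x n)); last first.
  by apply: funext => -[|k] //=; rewrite sharp0.
rewrite ghost_teichmuller -{1}[0%N]/(0 + 0)%N.
have := power_compatibleX 0 n (sharp_power_compatible x).
by rewrite add0n addn0 => ->; rewrite subrr; exact: dvr0.
Qed.

Lemma theta_surj (s : S) : exists y, theta y = s.
Proof.
have /choice[f fP] a : exists xb : T * S, a = sharp xb.1 0 + p%:R * xb.2.
  have [x /dvr_sym[r e]] := tilt_lift a.
  by exists (x, r) => /=; rewrite mulrC -e addrC subrK.
pose c n := iter n (fun a => (f a).2) s.
(* The [p ^ k]-th power cancels the root that [theta] extracts from the [k]-th coordinate. *)
exists (Witt pr (fun k => (f (c k)).1 ^+ (p ^ k))); apply: theta_eq => n.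
suff -> : s = ghost p (fun k => sharp ((f (c k)).1 ^+ (p ^ k)) n) n +
              p%:R ^+ n.+1 * c n.+1.
  by rewrite addrAC subrr add0r; exact: dvr_mull.
have sharpk k : (k <= n)%N -> forall x,
    sharp (x ^+ (p ^ k)) n ^+ (p ^ (n - k)) = sharp x 0.
  move=> kn x; rewrite sharpX -exprM -expnD subnKC //.
  by have := power_compatibleX 0 n (sharp_power_compatible x); rewrite add0n.
have -> : ghost p (fun k => sharp ((f (c k)).1 ^+ (p ^ k)) n) n =
    \sum_(k < n.+1) p%:R ^+ k * sharp (f (c k)).1 0.
  by apply: eq_bigr => k _; rewrite sharpk // -ltnS.
elim: n {sharpk} => [|n IH].
  by rewrite big_ord_recl big_ord0 addr0 mul1r expr1 -fP.
by rewrite big_ord_recr /= -addrA [_ ^+ n.+2]exprSr -mulrA -mulrDr -fP.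
Qed.

(** Two such maps agree modulo [p], hence exactly on Teichmueller elements, which have [p ^ n]-th
    roots. Every Witt vector is such an element plus a multiple of [p], and induction gives
    agreement modulo each [p ^ n]. *)
Lemma fontaine_map_unique (th th' : {rmorphism witt pr T -> S}) :
  is_fontaine_map th -> is_fontaine_map th' -> th' =1 th.
Proof.
move=> hth hth'.
have modp_eq y : p%:R %|| th' y - th y.
  by apply/dvr_quot; apply: etrans (hth' y) (esym (hth y)).
have teich_eq x : th' (teichmuller pr x) = th (teichmuller pr x).
  apply: (adic_eq p_complete) => n; apply: (@dvr_exp_leq _ _ n n.+1) => //.
  have [y <-] := tilt_rootX n x; rewrite teichmullerX !rmorphXn /=.
  by apply: dvr_lift_iter; [exact: dvr_refl|exact: modp_eq].
move=> y; apply: (adic_eq p_complete) => n.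
elim: n y => [|n IH] y; first by exists (th' y - th y); rewrite mulr1.
have [z yz] := witt_sub_teichmuller y tilt_char tilt_root.
rewrite -(subrK (teichmuller pr (y 0%N)) y) yz !rmorphD /= teich_eq.
rewrite opprD addrACA subrr addr0 !rmorphM !rmorph_nat /= -mulrBl exprSr.
by apply: dvr_mul; [exact: IH|exact: dvr_refl].
Qed.

(** * The kernel of Fontaine's map *)

Hypothesis frob_inj : forall y : S, w ^+ p %|| y ^+ p -> w %|| y.
Hypothesis tors_surj :
  forall m : S, w * m = 0 -> exists2 m', w * m' = 0 & m' ^+ p = m.
Hypothesis tors_reduced : forall m : S, w * m = 0 -> m ^+ p = 0 -> m = 0.

(** A sharp lift of [w] modulo [p] works: as [p >= 2], the error is a multiple of [w ^+ 2], so the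
    lift is [w] times a unit [1 + w * x]. *)
Lemma tilt_uniformizer : exists pi : T, w %|| sharp pi 0 /\ sharp pi 0 %|| w.
Proof.
have [pi [r e]] := tilt_lift w; exists pi.
have [s e'] := w_dvr_p.
have p2 : p = p.-2.+2 by case: p pr => [|[|]].
have e2 : sharp pi 0 = w * (1 + w * (r * s * w ^+ p.-2)).
  rewrite -[LHS](subrK w) e e' [in w ^+ p]p2 !exprS; ring.
split; first by rewrite e2; exact: dvr_mull.
have [v hv] := unit_1addM (r * s * w ^+ p.-2) w_complete.
by exists v; rewrite e2 mulrCA [v * _]mulrC hv mulr1.
Qed.

Section Uniformizer.
Variable pi : T.
Hypotheses (w_pi : w %|| sharp pi 0) (pi_w : sharp pi 0 %|| w).

Lemma tilt_red_pi n : tilt_red n (pi ^+ (p ^ n)) = 0.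
Proof. by rewrite rmorphXn /= tilt_redXn; apply/tilt_red_eq0. Qed.

(* The kernel E of the zeroth reduction satisfies E = pi T + E^p. *)
Lemma tilt_red0_step (x : T) : tilt_red 0 x = 0 ->
  exists z y, x = pi * z + y ^+ p /\ tilt_red 0 y = 0.
Proof.
move=> /tilt_red_eq0 wx; have [r e] := dvr_trans pi_w wx.
have [z hz] := tilt_lift r; have [y ey] := tilt_root (x - pi * z).
exists z, y; split; first by rewrite ey addrC subrK.
apply/tilt_red_eq0/frob_inj; rewrite -sharpX ey.
apply: dvr_trans w_dvr_p _.
rewrite -[sharp _ 0](subrK (sharp x 0 - sharp (pi * z) 0)).
apply: dvrD; first exact: sharpB.
rewrite e sharpM mulrC -mulrBr; apply: dvrM; exact: dvr_sym.
Qed.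

(** Iterating the previous step, [x = pi * u n + y n ^+ (p ^ n)], and the partial quotients [u n]
    converge. *)
Lemma tilt_red0_dvr (x : T) : tilt_red 0 x = 0 -> exists z, x = pi * z.
Proof.
move=> x0.
have /choice[f fP] (y : T) : exists zy : T * T, tilt_red 0 y = 0 ->
    y = pi * zy.1 + zy.2 ^+ p /\ tilt_red 0 zy.2 = 0.
  have [/tilt_red0_step[z [y' h]]|h] := pselect (tilt_red 0 y = 0).
    by exists (z, y').
  by exists (0, 0).
pose y n := iter n (fun a => (f a).2) x; pose z n := (f (y n)).1.
have y0 n : tilt_red 0 (y n) = 0 by elim: n => //= n /fP[].
have yS n : y n = pi * z n + y n.+1 ^+ p by case: (fP _ (y0 n)).
pose u n := \sum_(k < n) pi ^+ (p ^ k).-1 * z k ^+ (p ^ k).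
have xE n : x = pi * u n + y n ^+ (p ^ n).
  elim: n => [|n IH]; first by rewrite /u big_ord0 mulr0 add0r expr1.
  rewrite {1}IH {1}(yS n) tilt_exprD // /u big_ord_recr /= mulrDr addrA.
  congr (_ + _ + _); last by rewrite -exprM expnS.
  by rewrite exprMn mulrA -exprS prednK // expn_gt0 prime_gt0.
(* The shift by one matters: the term of index [n.+1] has exponent [p ^ n.+1 - 1 >= p ^ n] in [pi]
   and dies under the [n]-th reduction, whereas [p ^ n - 1] would fall short. *)
have [n|s hs] := @tilt_limit (fun n => u n.+1).
  rewrite /u big_ord_recr rmorphD /= [X in _ + X](_ : _ = 0) ?addr0 //.
  have -> : (p ^ n.+1).-1 = (p ^ n + (p ^ n.+1 - (p ^ n).+1))%N.
    rewrite subnS -subn1 addnC; apply/esym; rewrite -subn1 addnBAC ?subnK //.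
      by rewrite leq_exp2l ?prime_gt1.
    by rewrite subn_gt0 ltn_exp2l ?prime_gt1.
  by rewrite exprD !rmorphM /= tilt_red_pi !mul0r.
exists s; apply: tilt_red_inj => n.
rewrite {1}(xE n.+1) rmorphD !rmorphM /= hs rmorphXn /= expnSr exprM tilt_redXn
  [tilt_red 0 _](y0 n.+1).
by rewrite expr0n eqn0Ngt prime_gt0 // addr0.
Qed.

(** Successive [p]-th roots of [m] inside the torsion define [x]. The [n]-th sharp of [pi * x] is
    torsion and its [p ^ n]-th power is a multiple of [w * m = 0], so it vanishes by reducedness. *)
Lemma tilt_torsion (m : S) : w * m = 0 ->
  exists2 x : T, sharp x 0 = m & pi * x = 0.
Proof.
move=> wm.
have /choice[f fP] (a : S) : exists b, w * a = 0 -> w * b = 0 /\ b ^+ p = a.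
  have [/tors_surj[b]|h] := pselect (w * a = 0); first by exists b.
  by exists 0.
have wf n : w * iter n f m = 0 by elim: n => //= n /fP[].
have fc : power_compatible p (fun n => iter n f m).
  by move=> n; case: (fP _ (wf n)).
have [x xf] := sharp_surj fc; exists x; first exact: xf.
have nil k a : w * a = 0 -> a ^+ (p ^ k) = 0 -> a = 0.
  move=> wa; elim: k => [|k IH]; rewrite ?expr1 // expnSr exprM => /tors_reduced h.
  apply/IH/h; have -> : (p ^ k = (p ^ k).-1.+1)%N.
    by rewrite prednK // expn_gt0 prime_gt0.
  by rewrite exprS mulrA wa mul0r.
apply: tilt_red_inj => n; rewrite rmorph0; apply/tilt_red_eq0.
suff -> : sharp (pi * x) n = 0 by exact: dvr0.
apply: (nil n); first by rewrite sharpM xf mulrCA wf mulr0.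
have [a ea] := w_pi.
have := power_compatibleX 0 n (sharp_power_compatible (pi * x)).
by rewrite add0n => ->; rewrite sharpM xf ea -mulrA wm mulr0.
Qed.

Section Generator.
Variable xi alpha : witt pr T.
Hypothesis xiE : p%:R = xi + teichmuller pr pi * alpha.
Hypothesis xi_ker : theta xi = 0.

(** Write [x = [x 0] + p * y] with [x 0 = pi * z] and substitute [p = xi + [pi] * alpha]. The
    cofactor of [[pi]] has torsion image under [theta]; subtracting [[m]] corrects it without
    changing the product, as [pi * m = 0]. *)
Lemma ker_theta_step x : theta x = 0 ->
  exists b c, x = xi * b + teichmuller pr pi * c /\ theta c = 0.
Proof.
move=> x0.
have [z ez] : exists z, x 0%N = pi * z.
  apply: tilt_red0_dvr; apply/tilt_red_eq0.
  have : modp (theta x) = tilt_proj 0 (x 0%N) by exact: theta_fontaine.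
  rewrite x0 -sharpE => /dvr_quot h.
  by rewrite -[sharp _ _]subr0; apply: dvr_sym; exact: dvr_trans h.
have [y ey] := witt_sub_teichmuller x tilt_char tilt_root.
pose c := teichmuller pr z + alpha * y.
have xc : x = xi * y + teichmuller pr pi * c.
  rewrite -[LHS](subrK (teichmuller pr (x 0%N))) ey ez teichmullerM xiE /c; ring.
have [m mc pim] : exists2 m : T, sharp m 0 = theta c & pi * m = 0.
  have h : theta xi * theta y + theta (teichmuller pr pi) * theta c = 0.
    by rewrite -x0 xc -!rmorphM -rmorphD.
  move: h; rewrite xi_ker mul0r add0r theta_teichmuller => h.
  by apply: tilt_torsion; have [a ->] := pi_w; rewrite -mulrA h mulr0.
exists y, (c - teichmuller pr m); split.
  by rewrite mulrBr -teichmullerM pim teichmuller0 subr0.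
by rewrite rmorphB /= theta_teichmuller mc subrr.
Qed.

Lemma ker_theta x : theta x = 0 -> exists b, x = xi * b.
Proof.
move=> x0.
have /choice[f fP] (y : witt pr T) : exists bc : witt pr T * witt pr T,
    theta y = 0 -> y = xi * bc.1 + teichmuller pr pi * bc.2 /\ theta bc.2 = 0.
  have [/ker_theta_step[b [c h]]|h] := pselect (theta y = 0).
    by exists (b, c).
  by exists (0, 0).
pose c n := iter n (fun a => (f a).2) x; pose b n := (f (c n)).1.
have c0 n : theta (c n) = 0 by elim: n => //= n /fP[].
have cS n : c n = xi * b n + teichmuller pr pi * c n.+1 by case: (fP _ (c0 n)).
pose u n := \sum_(k < n) teichmuller pr pi ^+ k * b k.
have xE n : x = xi * u n + teichmuller pr pi ^+ n * c n.
  elim: n => [|n IH]; first by rewrite /u big_ord0 mulr0 add0r mul1r.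
  rewrite {1}IH {1}(cS n) /u big_ord_recr /= exprSr; ring.
have red0 n : witt_map (tilt_red n) (teichmuller pr (pi ^+ (p ^ n))) = 0.
  by rewrite (witt_map_teichmuller _ (tilt_red n)) /= tilt_red_pi teichmuller0.
(* The Witt vectors are complete for the filtration by the kernels of
   [witt_map (tilt_red n)], and [pi]^(p^n) lies in the n-th one. *)
have pi0 n m : (p ^ n <= m)%N ->
    witt_map (tilt_red n) (teichmuller pr pi ^+ m) = 0.
  move=> /subnK <-; rewrite exprD rmorphM -(teichmullerX _ pi (p ^ n)).
  by rewrite [X in _ * X](red0 n) mulr0.
have ustep n m : (p ^ n <= m)%N ->
    witt_map (tilt_red n) (u m) = witt_map (tilt_red n) (u (p ^ n)%N).
  move=> /subnK <-; elim: (m - p ^ n)%N => // d IH.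
  rewrite addSn /u big_ord_recr rmorphD rmorphM /= pi0 ?leq_addl // mul0r addr0.
  exact: IH.
(* The [n]-th reduction of [u m] is constant from [m = p ^ n] on, so the subsequence at the powers
   of [p] converges in each coordinate. *)
have /choice[s sP] k : exists s, forall n,
    tilt_red n s = tilt_red n (u (p ^ n)%N k).
  apply: tilt_limit => n.
  have := congr1 (fun z : witt pr _ => z k) (@ustep n (p ^ n.+1)%N _) => /= -> //.
  by rewrite leq_exp2l ?prime_gt1.
exists (Witt pr s).
have eqn n : witt_map (tilt_red n) x = witt_map (tilt_red n) (xi * Witt pr s).
  rewrite {1}(xE (p ^ n)%N) rmorphD !rmorphM /= pi0 // mul0r addr0.
  by congr (_ * _); apply: witt_ext => k; rewrite /= sP.
apply: witt_ext => k; apply: tilt_red_inj => n.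
exact: (congr1 (fun z : witt pr _ => z k) (eqn n)).
Qed.

End Generator.
End Uniformizer.

Lemma perfectoid_criterion :
  adically_complete_separated (principal_ideal w) -> perfectoid_ring pr S.
Proof.
move=> wa; split.
- by exists w => //; have [a ->] := w_dvr_p; exists a.
- move=> x; have [y /dvr_quot h] := frob_surj (quot_repr x).
  exists (modp y); apply: etrans (esym (rmorphXn modp p y)) _.
  by apply: etrans (esym h) _; exact: quot_reprK.
exists theta; split; first exact: theta_fontaine.
  by move=> th'; apply: fontaine_map_unique; exact: theta_fontaine.
have [pi [w_pi pi_w]] := tilt_uniformizer.
have [a ea] : sharp pi 0 %|| p%:R.
  exact: dvr_trans pi_w w_dvr.
have [alpha ealpha] := theta_surj a.
pose xi := p%:R - teichmuller pr pi * alpha.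
have xi0 : theta xi = 0.
  by rewrite rmorphB rmorphM rmorph_nat /= theta_teichmuller ealpha ea mulrC subrr.
exists xi; apply/seteqP; split=> x.
  move=> /(ker_theta w_pi pi_w (xi := xi) (alpha := alpha) _ xi0)[|b ->].
    by rewrite /xi subrK.
  by apply/principal_idealP; exists b; rewrite mulrC.
by move=> /principal_idealP[b ->] /=; rewrite rmorphM /= xi0 mulr0.
Qed.

End PerfectoidCriterion.

(** * Completion along a principal ideal *)

Lemma ideal_pow_principalP (A : comPzRingType) (w x : A) n :
  ideal_pow (principal_ideal w) n x <-> w ^+ n %|| x.
Proof.
elim: n x => [|n IH] x; first by rewrite expr0; exact: dvrP.
split=> [h|[r ->]].
  apply/dvrP; move: h; apply: ideal_gen_sub => _ [a /dvrP wa [b /IH wb <-]].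
  by apply/dvrP; rewrite exprS; exact: dvr_mul.
rewrite exprS mulrCA; apply: sub_ideal_gen; exists w.
  by apply/dvrP; exact: dvr_refl.
by exists (r * w ^+ n) => //; apply/IH; exact: dvr_mulr.
Qed.

Lemma completion_coherent (R : comPzRingType) (I : ideal R)
    (s : completion I) n :
  quot_proj (ideal_pow I n) (quot_repr (s n.+1)) = s n.
Proof. exact: (invlim_valP s n). Qed.

Lemma completion_of_cauchy (R : comPzRingType) (I : ideal R) (a : nat -> R) :
  (forall n, ideal_pow I n (a n.+1 - a n)) ->
  exists s : completion I, forall n, s n = quot_proj (ideal_pow I n) (a n).
Proof.
move=> ha.
have aP n : @quot_map R R idfun (ideal_pow I n.+1) (ideal_pow I n)
    (@ideal_powS R I n) (quot_proj (ideal_pow I n.+1) (a n.+1)) =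
    quot_proj (ideal_pow I n) (a n).
  by rewrite quot_mapE; apply/quot_projP; exact: ha.
by exists (InverseLimit (Q := fun n => quotient (ideal_pow I n)) aP).
Qed.

Lemma adic_complete_separated (A : comPzRingType) (w : A) : adic_complete w ->
  adically_complete_separated (principal_ideal w).
Proof.
move=> [sep pre].
have inj : injective (to_completion (principal_ideal w)).
  move=> x y e; apply/subr0_eq/sep => n; apply/ideal_pow_principalP/quot_projP.
  exact: (congr1 (fun z : completion (principal_ideal w) => z n) e).
have /choice[g gP] (s : completion (principal_ideal w)) :
    exists x, to_completion (principal_ideal w) x = s.
  have [n|x xs] := pre (fun n => quot_repr (s n)).
    apply/ideal_pow_principalP/quot_projP; rewrite [RHS]quot_reprK.
    exact: completion_coherent.
  exists x; apply: invlim_ext => n; rewrite -[RHS]quot_reprK.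
  by apply/quot_projP/ideal_pow_principalP.
by exists g => [x|s]; [exact/inj/gP|exact: gP].
Qed.

Section FrobeniusLift.
Variables (p : nat) (pr : prime p) (S : comPzRingType).

(** Middle binomial coefficients are multiples of [p], and each middle term keeps a factor [v]; with
    [v] divisible by [w ^+ n], the errors form a convergent series. *)
Lemma dvr_exprD_prime (u v : S) : p%:R * v %|| (u + v) ^+ p - (u ^+ p + v ^+ p).
Proof.
have defp := prednK (prime_gt0 pr).
rewrite exprDn big_ord_recr subnn -defp big_ord_recl /= defp.
rewrite subn0 !expr0 mulr1 mul1r bin0 binn !mulr1n.
have sumE (a b c : S) : a + b + c - (a + c) = b by ring.
rewrite sumE.
elim/big_ind: _ => [||i _]; [exact: dvr0|by move=> *; exact: dvrD|].
have /dvdnP[q ->] : (p %| 'C(p, bump 0 i))%N.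
  by apply: prime_dvd_bin => //=; rewrite -{2}defp ltnS (valP i).
rewrite -[_ *+ (q * p)]mulr_natr natrM /bump add1n exprS.
by exists (u ^+ (p - i.+1) * v ^+ i * q%:R); ring.
Qed.

(* Writing x = y_0^p + w^p x_1, x_1 = y_1^p + w^p x_2 and so on, x is congruent
   to the p-th power of the sum of the w^k y_k. *)
Lemma frob_surj_lift (w : S) : adic_complete w ->
  (forall x : S, exists y, w ^+ p %|| x - y ^+ p) ->
  forall x : S, exists y, p%:R %|| x - y ^+ p.
Proof.
move=> wc /choice[f fP] x.
have /choice[g gP] a : exists b, a = f a ^+ p + w ^+ p * b.
  by have [b e] := fP a; exists b; rewrite mulrC -e addrC subrK.
pose X n := iter n g x; pose u n := \sum_(k < n) w ^+ k * f (X k).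
have /choice[c cP] n : exists c,
    u n.+1 ^+ p = u n ^+ p + (w ^+ n * f (X n)) ^+ p + p%:R * (w ^+ n * c).
  have [r e] := dvr_exprD_prime (u n) (w ^+ n * f (X n)).
  exists (f (X n) * r); rewrite [u n.+1]big_ord_recr -/(u n).
  rewrite -[LHS](subrK (u n ^+ p + (w ^+ n * f (X n)) ^+ p)).
  by rewrite e; ring.
pose v n := \sum_(k < n) w ^+ k * c k.
have xE n : x = u n ^+ p + p%:R * - v n + w ^+ (p * n) * X n.
  elim: n => [|n IH].
    rewrite /u /v !big_ord0 muln0 expr0 mul1r oppr0 mulr0 addr0 expr0n.
    by rewrite eqn0Ngt prime_gt0 // add0r.
  have vS : v n.+1 = v n + w ^+ n * c n by rewrite /v big_ord_recr.
  have XS : X n = f (X n) ^+ p + w ^+ p * X n.+1 by exact: gP.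
  rewrite {1}IH (cP n) vS {1}XS mulnS exprD exprMn -exprM [(n * p)%N]mulnC; ring.
have lim (b : nat -> S) : exists s, forall n,
    w ^+ n %|| s - \sum_(k < n) w ^+ k * b k.
  by apply: wc.2 => n; rewrite big_ord_recr /= addrAC subrr add0r; exact: dvr_mull.
have [y hy] := lim (fun k => f (X k)); have [d hd] := lim c.
exists y, (- d); apply: (adic_eq wc) => n.
have -> : x - y ^+ p - - d * p%:R =
    w ^+ (p * n) * X n - (y ^+ p - u n ^+ p) + p%:R * (d - v n).
  by rewrite {1}(xE n); ring.
apply: dvrD; last exact: dvrM.
apply: dvrB; last exact: dvr_subX.
rewrite mulrC; apply: dvrM; apply: dvr_exp_leq (dvr_refl _).
by rewrite leq_pmull ?prime_gt0.
Qed.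

End FrobeniusLift.

Section PrincipalCompletion.
Variables (A : comPzRingType) (w : A).
Local Notation S := (completion (principal_ideal w)).
Local Notation iota := (to_completion (principal_ideal w)).
Local Notation quotw n := (quotient (ideal_pow (principal_ideal w) n)).

Lemma to_completion_is_zmod : zmod_morphism iota.
Proof. by move=> x y; apply: invlim_ext => n /=; rewrite raddfB. Qed.
Lemma to_completion_is_monoid : monoid_morphism iota.
Proof.
by split=> [|x y]; apply: invlim_ext => n /=; rewrite ?rmorph1 ?rmorphM.
Qed.
HB.instance Definition _ := GRing.isZmodMorphism.Build A S iota
  to_completion_is_zmod.
HB.instance Definition _ := GRing.isMonoidMorphism.Build A S iota
  to_completion_is_monoid.

(** The delicate direction is from a vanishing component to divisibility. As [w] may be a zero
    divisor, the quotients [t k] of the representatives [a (n + k)] by [w ^+ n] are built coherently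
    from the differences, so that they define an element of the completion. *)
Lemma completion_dvr (s : S) n : s n = 0 <-> iota w ^+ n %|| s.
Proof.
split=> [|[r ->]]; last first.
  have -> : (r * iota w ^+ n) n = r n * quot_proj _ (w ^+ n).
    by rewrite -rmorphXn.
  rewrite [quot_proj _ _](_ : _ = 0) ?mulr0 // -(rmorph0 (quot_proj _)).
  by apply/quot_projP/ideal_pow_principalP; rewrite subr0; exact: dvr_refl.
pose a k := quot_repr (s k).
have aK k : quot_proj (ideal_pow (principal_ideal w) k) (a k) = s k.
  exact: quot_reprK.
have aS k : w ^+ k %|| a k.+1 - a k.
  apply/ideal_pow_principalP/quot_projP; rewrite [RHS]aK.
  exact: completion_coherent.
have aD k m : w ^+ k %|| a (m + k)%N - a k.
  elim: m => [|m IH]; first by rewrite subrr; exact: dvr0.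
  apply: dvr_subr_trans IH; apply: dvr_exp_leq (aS (m + k)%N); exact: leq_addl.
have /choice[c hc] := aS.
rewrite -aK -(rmorph0 (quot_proj _)) => /quot_projP/ideal_pow_principalP.
rewrite subr0 => -[d ed].
pose t k := d + \sum_(j < k) c (n + j)%N * w ^+ j.
have tE k : a (n + k)%N = t k * w ^+ n.
  elim: k => [|k IH]; first by rewrite addn0 /t big_ord0 addr0.
  rewrite addnS -[LHS](subrK (a (n + k)%N)) hc IH /t big_ord_recr /= exprD; ring.
have [k|r rE] := @completion_of_cauchy A (principal_ideal w) t.
  apply/ideal_pow_principalP; exists (c (n + k)%N).
  by rewrite /t big_ord_recr /=; ring.
exists r; apply: invlim_ext => k.
transitivity (quot_proj (ideal_pow (principal_ideal w) k) (t k * w ^+ n)).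
  by rewrite -aK -tE; apply/quot_projP/ideal_pow_principalP; apply: dvr_sym;
    exact: aD.
by rewrite -[iota w ^+ n]rmorphXn [LHS]rmorphM /= -rE.
Qed.

Lemma completion_adic : adic_complete (iota w).
Proof.
split=> [x xP|u uP].
  by apply: invlim_ext => n; apply/completion_dvr.
have uE n : (u n.+1) n = (u n) n.
  by apply/subr0_eq; apply/(completion_dvr (u n.+1 - u n)).
have [n|s sE] := @completion_of_cauchy A (principal_ideal w)
    (fun n => quot_repr (u n n)).
  by apply/quot_projP; rewrite [RHS]quot_reprK -(uE n); exact: completion_coherent.
exists s => n; apply/completion_dvr.
by apply/eqP; rewrite subr_eq0 sE quot_reprK.
Qed.

Lemma completion_approx (s : S) n : exists a, iota w ^+ n %|| s - iota a.
Proof.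
exists (quot_repr (s n)); apply/completion_dvr.
by apply/eqP; rewrite subr_eq0 /= quot_reprK.
Qed.

Lemma to_completion_dvr a n : iota w ^+ n %|| iota a <-> w ^+ n %|| a.
Proof.
split=> [/completion_dvr h|[r ->]]; last by rewrite rmorphM rmorphXn;
  exact: dvr_mulr.
apply/ideal_pow_principalP; rewrite -[a]subr0; apply/quot_projP.
by rewrite rmorph0.
Qed.

Section Torsion.
Hypothesis tors_square : forall m : A, w * (w * m) = 0 -> w * m = 0.

(** An element killed by [iota] is a multiple of [w], and a torsion multiple of [w] is zero by
    [tors_square]. *)
Lemma to_completion_tors_inj m : w * m = 0 -> iota m = 0 -> m = 0.
Proof.
move=> wm m0; have /to_completion_dvr[r e] : iota w ^+ 1 %|| iota m.
  by rewrite m0; exact: dvr0.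
by move: wm; rewrite e expr1 mulrC mulrAC => h;
  rewrite mulrC tors_square // -h; ring.
Qed.

(** If [a] approximates [s] modulo [w ^+ n.+2], then [w * a = c * w ^+ n.+2], and
    [a - c * w ^+ n.+1] is torsion and approximates [s] with one power less. Two such approximations
    differ by a torsion multiple of [w], so all are equal. *)
Lemma completion_tors (s : S) : iota w * s = 0 ->
  exists2 m, w * m = 0 & s = iota m.
Proof.
move=> ws.
have /choice[m mP] n : exists m, w * m = 0 /\ iota w ^+ n.+1 %|| s - iota m.
  have [a ha] := completion_approx s n.+2.
  have [c ec] : w ^+ n.+2 %|| w * a.
    apply/to_completion_dvr.
    have -> : iota (w * a) = - (iota w * (s - iota a)).
      by rewrite mulrBr ws sub0r opprK rmorphM.
    by apply: dvrN; apply: dvrM.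
  exists (a - c * w ^+ n.+1); split.
    by rewrite mulrBr ec [w ^+ n.+2]exprS; ring.
  rewrite rmorphB rmorphM rmorphXn opprB addrCA; apply: dvrD.
    exact: dvr_mulr.
  exact: dvr_exp_leq ha.
have mS n : m n = m 0%N.
  apply/subr0_eq; have [wm h] := mP n; have [wm0 h0] := mP 0%N.
  have [d ed] : w ^+ 1 %|| m n - m 0%N.
    apply/to_completion_dvr; rewrite rmorphB -(subrKA s) addrC.
    apply: dvrD; rewrite // -opprB; apply: dvrN.
    by apply: dvr_exp_leq h.
  rewrite ed expr1 mulrC; apply: tors_square.
  by rewrite [w * d]mulrC -[w in d * w]expr1 -ed mulrBr wm wm0 subrr.
exists (m 0%N); first by case: (mP 0%N).
apply: (adic_eq completion_adic) => n.
by case: (mP n) => _; rewrite mS; apply: dvr_exp_leq.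
Qed.

End Torsion.

Variables (p : nat) (pr : prime p).
Hypothesis w_dvr_p : w ^+ p %|| p%:R.
Hypothesis frob_surj : forall a : A, exists b, w ^+ p %|| a - b ^+ p.
Hypothesis frob_inj : forall a : A, w ^+ p %|| a ^+ p -> w %|| a.
Hypothesis tors_square : forall m : A, w * (w * m) = 0 -> w * m = 0.
Hypothesis tors_surj :
  forall m : A, w * m = 0 -> exists2 m', w * m' = 0 & m' ^+ p = m.
Hypothesis tors_reduced : forall m : A, w * m = 0 -> m ^+ p = 0 -> m = 0.

Lemma perfectoid_completion : perfectoid_ring pr S.
Proof.
apply: (@perfectoid_criterion _ pr S (iota w)).
- exact: completion_adic.
- by rewrite -(rmorph_nat iota); apply/to_completion_dvr.
- apply: (frob_surj_lift pr completion_adic) => x.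
  have [a ha] := completion_approx x p; have [b hb] := frob_surj a.
  exists (iota b); apply: dvr_subr_trans ha _.
  by rewrite -(rmorphXn iota p b) -(rmorphB iota); apply/to_completion_dvr.
- move=> y hy; have [a ha] := completion_approx y p.
  have wa : w %|| a.
    apply: frob_inj; apply/to_completion_dvr; rewrite rmorphXn.
    rewrite -[X in _ %|| X](subrK (y ^+ p)); apply: dvrD => //.
    by apply: dvr_subX; exact: dvr_sym.
  rewrite -(subrK (iota a) y); apply: dvrD.
    by rewrite -[iota w]expr1; apply: dvr_exp_leq ha; exact: prime_gt0.
  by rewrite -[iota w]expr1; apply/to_completion_dvr; rewrite expr1.
- move=> s /(completion_tors tors_square)[m wm ->].
  have [m' wm' <-] := tors_surj wm; exists (iota m').
    by rewrite -rmorphM wm' rmorph0.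
  by rewrite rmorphXn.
- move=> s /(completion_tors tors_square)[m wm ->]; rewrite -rmorphXn => mp0.
  rewrite (tors_reduced wm) ?rmorph0 //.
  apply: (to_completion_tors_inj tors_square) => //.
  by rewrite -(prednK (prime_gt0 pr)) exprS mulrA wm mul0r.
exact: adic_complete_separated completion_adic.
Qed.

End PrincipalCompletion.

(** * The colimit of a perfectoid tower *)

Lemma dvr_rmorph (A B : comPzRingType) (f : {rmorphism A -> B}) (e x : A) :
  e %|| x -> f e %|| f x.
Proof. by move=> [r ->]; rewrite rmorphM; exact: dvr_mulr. Qed.

Lemma ideal_extension_principal (A B : comPzRingType) (f : {rmorphism A -> B})
    (a : A) :
  ideal_extension f (principal_ideal a) = principal_ideal (f a).
Proof.
apply: ideal_ext; apply/seteqP; split.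
  apply: ideal_gen_sub => _ [x /dvrP ax <-]; apply/dvrP; exact: dvr_rmorph.
apply: ideal_gen_sub => _ ->; apply: sub_ideal_gen; exists a => //.
by apply/dvrP; exact: dvr_refl.
Qed.

Section PerfectoidTower.
Variables (p : nat) (pr : prime p) (R : nat -> comPzRingType).
Variables (t : forall i, {rmorphism R i -> R i.+1}).
Variables (a0 : R 0%N) (a1 : R 1%N).
Local Notation I0 := (principal_ideal a0).
Local Notation I1 := (principal_ideal a1).
Hypothesis tower : perfectoid_tower p t I0.
Hypothesis pillar : first_pillar p t I0 I1.

Local Notation A := (colim t).
(** [b i] generates the extension of I_0 to [R i], and [e i] that of I_1 to [R i.+1], with a shift
    of index; [w] is the common image of all [e i]. *)
Local Notation b i := (tower_map t i a0).
Local Notation e i :=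
  (tower_map (R := fun j => R j.+1) (fun j => t j.+1) i a1).
Local Notation w := (colim_in t a1).

Let insep : purely_inseparable p t I0.
Proof. by case: tower. Qed.

Lemma base_idealE i x : base_ideal t I0 i x <-> b i %|| x.
Proof. by rewrite /base_ideal ideal_extension_principal; exact: dvrP. Qed.

Lemma pillarX_dvr i : e i ^+ p %|| b i.+1 /\ b i.+1 %|| e i ^+ p.
Proof.
elim: i => [|i [h1 h2]].
  case: pillar => _ h _; split.
    by apply/ideal_pow_principalP; rewrite h; apply/base_idealE; exact: dvr_refl.
  by apply/base_idealE; rewrite -h; apply/ideal_pow_principalP; exact: dvr_refl.
by split; [move: h1|move: h2] => /(dvr_rmorph (t i.+1)); rewrite rmorphXn.
Qed.

Lemma pillar_dvr i : e i %|| b i.+1.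
Proof.
apply: dvr_trans (pillarX_dvr i).1; rewrite -{1}[e i]expr1.
by apply: dvr_exp_leq (dvr_refl _); exact: prime_gt0.
Qed.

(** * Torsion in the tower *)

Lemma torsionE i m : torsion t I0 m <-> b i * m = 0.
Proof.
split=> [tm|bm].
  have [_ _ _ _ /(_ i)[h _]] := tower; apply: h => //.
  by apply/dvrP; exact: dvr_refl.
move=> x /dvrP[r ->]; exists 1%N; split=> //.
by rewrite expr1 rmorphM -mulrA bm mulr0.
Qed.

Lemma torsion_sq i m : b i * (b i * m) = 0 -> b i * m = 0.
Proof.
move=> h; apply/torsionE => x /dvrP[r ->]; exists 2; split=> //.
have sqE (u v : R i) : (u * v) ^+ 2 * m = u ^+ 2 * (v * (v * m)) by ring.
by rewrite rmorphM sqE h mulr0.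
Qed.

(* Torsion embeds in the reduction modulo I_0, so that the map g of axiom (g) is
   determined by Frobenius there: t (g m) = m^p. *)
Lemma torsion_base i m : b i * m = 0 -> base_ideal t I0 i m -> m = 0.
Proof.
by move=> bm /base_idealE[r em]; move: bm; rewrite em mulrC => h;
  rewrite mulrC torsion_sq // mulrA -h; ring.
Qed.

(** By injectivity of the reduced transition map, [m] lies in the ideal generated by I_0, which
    contains no nonzero torsion. *)
Lemma torsion_inj i m : b i * m = 0 -> t i m = 0 -> m = 0.
Proof.
move=> bm tm0; apply: (torsion_base bm).
have [_ inj _] := insep.
have /quot_projP : quot_proj (base_ideal t I0 i) m =
    quot_proj (base_ideal t I0 i) 0.
  by apply: inj; rewrite /tower_quot_map !quot_mapE tm0 !rmorph0.
by rewrite subr0.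
Qed.

Lemma frob_proj_quot i (x : R i) (y : R i.+1) :
  frob_proj p (quot_proj (base_ideal t I0 i.+1) y) =
    quot_proj (base_ideal t I0 i) x ->
  base_ideal t I0 i.+1 (t i x - y ^+ p).
Proof.
move=> h; apply/quot_projP; rewrite rmorphXn.
by rewrite -(frob_projE _ insep) h; apply: esym; exact: quot_mapE.
Qed.

(** [t i (g m)] and [m ^+ p] are torsion and congruent modulo I_0, hence equal. *)
Lemma torsion_frob i : exists g : R i.+1 -> R i,
  [/\ forall m, b i.+1 * m = 0 -> b i * g m = 0 /\ t i (g m) = m ^+ p,
      forall m m', b i.+1 * m = 0 -> b i.+1 * m' = 0 -> g m = g m' -> m = m' &
      forall y, b i * y = 0 -> exists2 m, b i.+1 * m = 0 & g m = y].
Proof.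
have [_ _ _ _ /(_ i)[_ [g [[gfun ginj gsurj] gF]]]] := tower.
exists g; split=> [m bm|m m' bm bm'|y by0].
- have bg : b i * g m = 0 by apply/torsionE/gfun/torsionE.
  split=> //; apply/subr0_eq/torsion_base.
    rewrite mulrBr -(prednK (prime_gt0 pr)) exprS mulrA bm mul0r subr0.
    by rewrite /= -rmorphM bg rmorph0.
  by apply: frob_proj_quot; apply: esym; apply: gF; apply/torsionE.
- by apply: ginj; apply/mem_set/torsionE.
have [m /torsionE bm gm] := gsurj y ((torsionE _).2 by0).
by exists m.
Qed.

(** [m ^+ p] is [t i (g m)], and both [g] and [t i] are injective on torsion. *)
Lemma torsion_reduced i (m : R i.+1) : b i.+1 * m = 0 -> m ^+ p = 0 -> m = 0.
Proof.
move=> bm mp; have [g [gP ginj _]] := torsion_frob i.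
have g0 x : b i.+1 * x = 0 -> x ^+ p = 0 -> g x = 0.
  by move=> /gP[bg tg] xp; apply: torsion_inj bg _; rewrite tg.
apply: ginj => //; first by rewrite mulr0.
by rewrite !g0 ?mulr0 // expr0n eqn0Ngt prime_gt0.
Qed.

Lemma torsion_root i (y : R i) : b i * y = 0 ->
  exists2 m, b i.+1 * m = 0 & m ^+ p = t i y.
Proof.
move=> by0; have [g [gP _ gsurj]] := torsion_frob i.
have [m bm gm] := gsurj y by0; exists m => //.
by have [_ <-] := gP m bm; rewrite gm.
Qed.

(** * Passage to the colimit *)

Lemma colim_in_b i : colim_in t (b i) = colim_in t a0.
Proof. by elim: i => //= i IH; rewrite colim_in_step. Qed.

Lemma colim_in_e i : colim_in t (e i) = w.
Proof. by elim: i => //= i IH; rewrite colim_in_step. Qed.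

Lemma colim_lift_b k i : colim_lift t k (b i) = b (k + i).
Proof. by elim: k => //= k ->. Qed.

Lemma colim_in_eq0 i (x : R i) : colim_in t x = 0 ->
  exists k, colim_lift t k x = 0.
Proof.
rewrite -(rmorph0 (colim_in t (i := i))) => /colim_in_eqP[k].
by rewrite rmorph0; exists k.
Qed.

Lemma wX_dvr : w ^+ p %|| colim_in t a0 /\ colim_in t a0 %|| w ^+ p.
Proof.
rewrite -(colim_in_b 1) -(rmorphXn (colim_in t (i := 1%N))).
by have [h1 h2] := pillarX_dvr 0; split; apply: dvr_rmorph.
Qed.

Lemma colim_base i (x : R i) : base_ideal t I0 i x -> w ^+ p %|| colim_in t x.
Proof.
move=> /base_idealE/(dvr_rmorph (colim_in t (i := i))).
by rewrite /= colim_in_b; apply: dvr_trans; case: wX_dvr.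
Qed.

Lemma colim_torsion m : colim_in t a0 * m = 0 ->
  exists i, exists2 y : R i.+1, b i.+1 * y = 0 & m = colim_in t y.
Proof.
have [i [x ->]] := colim_inK m; rewrite -(colim_in_b i) -rmorphM.
move=> /colim_in_eq0[k]; rewrite rmorphM /= colim_lift_b => bx.
(* One further transition map is applied, since [torsion_reduced] is available at the stages
   [i.+1]. *)
exists (k + i)%N, (t _ (colim_lift t k x));
  last by rewrite colim_in_step colim_in_lift.
by rewrite /= -rmorphM bx rmorph0.
Qed.

(* For y torsion, e y is torsion and its p-th power is divisible by b y = 0. *)
Lemma colim_tors_w m : colim_in t a0 * m = 0 -> w * m = 0.
Proof.
move=> /colim_torsion[i [y by0 ->]].
suff ey : e i * y = 0 by rewrite -(colim_in_e i) -rmorphM ey rmorph0.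
apply: torsion_reduced; first by rewrite mulrCA by0 mulr0.
have [_ [r er]] := pillarX_dvr i.
by rewrite exprMn er -(prednK (prime_gt0 pr)) exprS -mulrA (mulrA (b i.+1)) by0
  mul0r mulr0.
Qed.

Lemma colim_tors_b m : w * m = 0 -> colim_in t a0 * m = 0.
Proof.
move=> wm; have [[r ->] _] := wX_dvr.
by rewrite -(prednK (prime_gt0 pr)) exprSr -!mulrA wm !mulr0.
Qed.

(** As [p >= 2], [m] is killed by [w ^+ p], hence by I_0, and then by [w] itself. *)
Lemma colim_tors_square m : w * (w * m) = 0 -> w * m = 0.
Proof.
move=> wm; apply: colim_tors_w; have [[r ->] _] := wX_dvr.
have -> : p = p.-2.+2 by case: p pr => [|[|]].
by rewrite !exprSr -!mulrA wm !mulr0.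
Qed.

Lemma colim_tors_root m : w * m = 0 -> exists2 m', w * m' = 0 & m' ^+ p = m.
Proof.
move=> /colim_tors_b/colim_torsion[i [y by0 ->]].
have [m' bm' em'] := torsion_root by0; exists (colim_in t m').
  by apply: colim_tors_w; rewrite -(colim_in_b i.+2) -rmorphM bm' rmorph0.
by rewrite -rmorphXn em' /= colim_in_step.
Qed.

Lemma colim_tors_reduced m : w * m = 0 -> m ^+ p = 0 -> m = 0.
Proof.
move=> /colim_tors_b/colim_torsion[i [y by0 ->]].
rewrite -rmorphXn => /colim_in_eq0[k yp].
rewrite -(colim_in_lift _ k.+1) (_ : colim_lift t k.+1 y = 0) ?rmorph0 //.
apply: torsion_reduced => /=.
  by rewrite -/(b i.+1) -colim_lift_b -!rmorphM by0 !rmorph0.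
by rewrite -rmorphXn -(rmorphXn (@colim_lift R t k i.+1)) /= yp rmorph0.
Qed.

Lemma colim_frob_surj (a : A) : exists c, w ^+ p %|| a - c ^+ p.
Proof.
have [i [x ->]] := colim_inK a.
have [_ fsurj _ _ _] := tower.
have [y yx] := fsurj i (quot_proj (base_ideal t I0 i) x).
exists (colim_in t (quot_repr y)).
rewrite -(colim_in_step t x) -(rmorphXn (@colim_in R t i.+1) p (quot_repr y)).
rewrite -(rmorphB (@colim_in R t i.+1)); apply: colim_base.
by apply: frob_proj_quot; rewrite quot_reprK.
Qed.

(** At a finite stage [x ^+ p] is a multiple of [b], so the Frobenius projection kills the class of
    [x]; by (f-2) [x] lies in I_1 modulo I_0, and I_1 contains I_0 there. *)
Lemma colim_frob_inj (a : A) : w ^+ p %|| a ^+ p -> w %|| a.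
Proof.
move=> /(dvr_trans wX_dvr.2)[c ec].
have [n [x [y [_ [ex ey _]]]]] := colim_common3 a c a.
have /colim_in_eqP[k xy] : colim_in t (x ^+ p) = colim_in t (y * b n).
  by rewrite rmorphXn rmorphM /= colim_in_b -ex -ey.
(* The extra lift leads to stage [(k + n).+1], whose Frobenius projection has target the stage
   [k + n]. *)
pose X := colim_lift t k.+1 x.
suff [r rX] : e (k + n) %|| X.
  by rewrite ex -(colim_in_lift t k.+1 x) -/X rX rmorphM /= colim_in_e;
    exact: dvr_mulr.
have qX : frob_proj p (quot_proj (base_ideal t I0 (k + n).+1) X) = 0.
  have [_ inj _] := insep; apply: inj.
  rewrite frob_projE // rmorph0 -rmorphXn -(rmorph0 (quot_proj _)).
  apply/quot_projP/base_idealE; rewrite subr0.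
  exists (colim_lift t k.+1 y).
  transitivity (t _ (colim_lift t k (x ^+ p))); first by rewrite !rmorphXn.
  by rewrite xy !rmorphM /= colim_lift_b.
have [_ _ /(_ (k + n)%N)/seteqP[sub _]] := pillar.
have := sub _ qX; rewrite ideal_extension_principal => /dvrP[r].
rewrite -(quot_reprK r) /= -rmorphM => /quot_projP/base_idealE/(dvr_trans
  (pillar_dvr _)) h.
by rewrite -(subrK (quot_repr r * e (k + n)) X); apply: dvrD => //;
  exact: dvr_mulr.
Qed.

End PerfectoidTower.

Theorem corollary3p52 (p : nat) (pr : prime p) (R : nat -> comPzRingType)
    (t : forall i, {rmorphism R i -> R i.+1})
    (I0 : ideal (R 0%N)) (I1 : ideal (R 1%N)) :
  perfectoid_tower p t I0 ->
  first_pillar p t I0 I1 ->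
  perfectoid_ring pr
    (completion (ideal_extension (colim_in t (i := 1%N)) I1)).
Proof.
move=> tower pillar.
have [_ _ _ [[a0 e0] _] _] := tower; have [[a1 e1] _ _] := pillar.
subst I0 I1; rewrite ideal_extension_principal.
apply: perfectoid_completion.
- have [[Ip _ _] _ _ _ _] := tower.
  rewrite -(rmorph_nat (colim_in t (i := 0%N))); apply: (colim_base pillar).
  by apply/(base_idealE t); apply/dvrP.
- exact: (colim_frob_surj tower pillar).
- exact: (colim_frob_inj pr tower pillar).
- exact: (colim_tors_square pr tower pillar).
- exact: (colim_tors_root pr tower pillar).
- exact: (colim_tors_reduced pr tower pillar).
Qed.
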